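(* There is an absolute constant $C>0$ such that the following holds. Fix $j\in\mathbb N$ and write $\phi=\phi_j$, $\lambda=\lambda_j$. The function $x\mapsto x\phi'(x)$ (defined almost everywhere in $[0,1]$) is measurable and square integrable on $[0,1]$, and $$\int_0^1\big(x\phi'(x)\big)^2\,dx\le C\,|\lambda|^5(\log|\lambda|)^3.$$
   Context: Let $K:[0,1]\times[0,1]\to\mathbb R$ be defined by $K(x,y)=\frac12-\{(xy)^{-1}\}$ if $0<x,y\le 1$, and $K(x,y)=0$ if $0\le x,y\le1$ and $xy=0$, where $\{\alpha\}=\alpha-\lfloor\alpha\rfloor$. Let $L^2([0,1])$ denote the space of real-valued Lebesgue measurable square-integrable functions on $[0,1]$, with $\langle f,g\rangle=\int_0^1 f(x)g(x)\,dx$ and $\|f\|=\langle f,f\rangle^{1/2}$. A function $\phi$ is an eigenfunction of $K$ (with eigenvalue $\lambda\in\mathbb R$) if $\phi\in L^2([0,1])$, $\|\phi\|>0$, and $\phi(x)=\lambda\int_0^1 K(x,y)\phi(y)\,dy$ for every $x\in[0,1]$. Let $\phi_1,\phi_2,\ldots$ be a maximal orthonormal system in $L^2([0,1])$ of eigenfunctions of $K$, $\phi_j$ having the nonzero real eigenvalue $\lambda_j$, numbered so that $0<|\lambda_1|\le|\lambda_2|\le\cdots$ and $\lambda_j\ge\lambda_{j+1}$ whenever $|\lambda_j|=|\lambda_{j+1}|$. *)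

(* Defs.v *)
From HB Require Import structures.
From mathcomp Require Import all_boot all_order all_algebra.
From mathcomp Require Import all_classical all_reals all_analysis.
Set Implicit Arguments. Unset Strict Implicit. Unset Printing Implicit Defensive.
Import Order.TTheory GRing.Theory Num.Theory.
Import numFieldNormedType.Exports.
Local Open Scope classical_set_scope.
Local Open Scope ring_scope.

Section Defs.
Variable R : realType.
Local Notation mu := (@lebesgue_measure R).
Definition I01 : set R := `[0, 1]%classic.

Definition fracpart (a : R) : R := a - (Num.floor a)%:~R.

(* the kernel K on [0,1]^2; K = 0 when x y = 0 (values outside [0,1]^2 are
   irrelevant and set to 0) *)
Definition Kker (x y : R) : R :=
  if (0 < x <= 1) && (0 < y <= 1) then 2^-1 - fracpart ((x * y)^-1) else 0.

Definition L2_01 (f : R -> R) : Prop :=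
  measurable_fun I01 f /\
  (\int[mu]_(x in I01) ((f x) ^+ 2)%:E < +oo)%E.

Definition inner01 (f g : R -> R) : R :=
  fine (\int[mu]_(x in I01) (f x * g x)%:E)%E.

Definition norm01 (f : R -> R) : R := Num.sqrt (inner01 f f).

Definition eigenfunction (phi : R -> R) (lam : R) : Prop :=
  L2_01 phi /\ 0 < norm01 phi /\
  forall x, I01 x ->
    phi x = lam * fine (\int[mu]_(y in I01) (Kker x y * phi y)%:E)%E.

(* phi_0, phi_1, ... (paper's phi_1, phi_2, ...) is a maximal orthonormal
   system of eigenfunctions with nonzero eigenvalues lam_j, numbered as in
   the paper *)
Definition ordered_max_eigensystem (phi : nat -> R -> R) (lam : nat -> R) :
  Prop :=
  [/\ forall j, lam j != 0 /\ eigenfunction (phi j) (lam j),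
      forall i j, inner01 (phi i) (phi j) = (if i == j then 1 else 0),
      forall psi nu, nu != 0 -> eigenfunction psi nu ->
        ~ (forall j, inner01 psi (phi j) = 0),
      forall j, `|lam j| <= `|lam j.+1| &
      forall j, `|lam j| = `|lam j.+1| -> lam j.+1 <= lam j].

End Defs.

(* Main.v *)
(* Write [k t = 1/2 - {1/t}], so that [phi x = lam * int_0^1 k (x y) phi y dy],
   and [D_q x = phi x - phi (q x)] for [q < 1].  Since the kernel only depends on
   [x y], a dilation of [phi] can be traded for a dilation of the kernel:
     D_q x = - lam * int_0^1 k (q x y) D_q y dy + O(1 - q).
   The same identity at the points [q^i x] telescopes when summed over [i < N],
   and replacing [k (q^i q x y)] by [k (q x y)] costs, by Cauchy-Schwarz, the L^2
   norm of a kernel increment.  Hence [D_q x] differs from [D_(q^N) x / N] by at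
   most [|lam| sqrt(w) ||D_q|| + O(1 - q)], where [w -> 0] as [N (1 - q) -> 0].
   Taking [N (1 - q)] of order [lam^-2 (log |lam|)^-2] lets us absorb [||D_q||] and
   gives [||D_q|| = O((1 - q) lam^2 (log |lam|)^2)].  With this in hand the same
   inequality, read at a fixed [x] with [1/x] not an integer, shows that the
   difference quotients of [phi] are Cauchy, so [phi] is differentiable off a
   countable set, and Fatou's lemma bounds the norm of [x phi'(x)]. *)
Require Import Defs.
From HB Require Import structures.
From mathcomp Require Import all_boot all_order all_algebra.
From mathcomp Require Import all_classical all_reals all_analysis.
From mathcomp Require Import measurable_realfun ring lra.
Set Implicit Arguments.
Unset Strict Implicit.
Unset Printing Implicit Defensive.
Import Order.TTheory GRing.Theory Num.Theory.
Import numFieldNormedType.Exports.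
Local Open Scope classical_set_scope.
Local Open Scope ring_scope.

(** * Bounded measurable functions on [[0, 1]] and integration under dilation *)

Section BoundedMeasurable.
Context {R : realType}.
Local Notation mu := (@lebesgue_measure R).
Implicit Types (f g : R -> R) (q : R).

(** Normalized eigenfunctions turn out to be bounded, so this class holds the integrands built from
    them and the kernel. It is stable under products and dilations and makes integrability
    automatic. *)
Definition bmeas01 f :=
  measurable_fun (@I01 R) f /\ exists M, forall x, I01 x -> `|f x| <= M.

Definition int01 f : R := \int[mu]_(x in @I01 R) f x.

Lemma I01P (x : R) : I01 x <-> 0 <= x <= 1.
Proof. by rewrite /I01 /= in_itv. Qed.

Lemma measurable_I01 : measurable (@I01 R).
Proof. exact: measurable_itv. Qed.
#[local] Hint Resolve measurable_I01 : core.

Lemma mu_I01 : mu (@I01 R) = 1%E.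
Proof. by rewrite /I01 lebesgue_measure_itv /= lte_fin ltr01 oppr0 adde0. Qed.

Lemma bmeas01_integrable f : bmeas01 f -> mu.-integrable (@I01 R) (EFin \o f).
Proof.
move=> [mf [M fM]]; apply: measurable_bounded_integrable => //.
  by rewrite -[X in (X < _)%E]/(mu (@I01 R)) mu_I01 ltry.
exists M; split; first exact: num_real.
by move=> x Mx y Iy /=; apply: le_trans (fM _ Iy) (ltW Mx).
Qed.

Lemma bmeas01_cst c : bmeas01 (fun=> c).
Proof. by split; [exact: measurable_cst | exists `|c|]. Qed.

Lemma bmeas01D f g : bmeas01 f -> bmeas01 g -> bmeas01 (fun x => f x + g x).
Proof.
move=> [mf [M fM]] [mg [M' gM]]; split; first exact: measurable_funD.
exists (M + M') => x Ix; apply: le_trans (ler_normD _ _) _.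
exact: lerD (fM _ Ix) (gM _ Ix).
Qed.

Lemma bmeas01M f g : bmeas01 f -> bmeas01 g -> bmeas01 (fun x => f x * g x).
Proof.
move=> [mf [M fM]] [mg [M' gM]]; split; first exact: measurable_funM.
exists (M * M') => x Ix; rewrite normrM.
by apply: ler_pM (fM _ Ix) (gM _ Ix).
Qed.

Lemma bmeas01Z c f : bmeas01 f -> bmeas01 (fun x => c * f x).
Proof. exact: bmeas01M (bmeas01_cst c). Qed.

Lemma bmeas01B f g : bmeas01 f -> bmeas01 g -> bmeas01 (fun x => f x - g x).
Proof.
move=> bf /(bmeas01Z (-1)) /(bmeas01D bf).
by under eq_fun do rewrite mulN1r.
Qed.

Lemma bmeas01X f n : bmeas01 f -> bmeas01 (fun x => f x ^+ n).
Proof.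
move=> bf; elim: n => [|n IH]; first by under eq_fun do rewrite expr0; exact: bmeas01_cst.
by under eq_fun do rewrite exprS; exact: bmeas01M.
Qed.

Lemma bmeas01_norm f : bmeas01 f -> bmeas01 (fun x => `|f x|).
Proof.
move=> [mf [M fM]]; split; first exact: measurableT_comp.
by exists M => x Ix; rewrite normr_id; exact: fM.
Qed.

Lemma bmeas01_if q f g : bmeas01 f -> bmeas01 g ->
  bmeas01 (fun x => if x <= q then f x else g x).
Proof.
move=> [mf [M fM]] [mg [M' gM]]; split.
  apply: measurable_fun_if => //=.
  - by apply: measurable_fun_ler => //; exact: measurable_cst.
  - by apply: measurable_funS mf => //; exact: subIsetl.
  - by apply: measurable_funS mg => //; exact: subIsetl.
exists (Num.max M M') => x Ix; case: ifP => _; rewrite le_max.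
  by rewrite fM.
by rewrite gM ?orbT.
Qed.

Lemma I01_scale q (x : R) : 0 <= q <= 1 -> I01 x -> I01 (q * x).
Proof.
move=> /andP[q0 q1] /I01P/andP[x0 x1]; apply/I01P.
by rewrite mulr_ge0 //= mulr_ile1.
Qed.

Lemma bmeas01_scale q f : 0 <= q <= 1 -> bmeas01 f -> bmeas01 (fun x => f (q * x)).
Proof.
move=> q01 [mf [M fM]]; split.
  apply: (@measurable_comp _ _ _ _ _ _ (@I01 R) f (@I01 R) ( *%R q)) => //.
  by move=> _ [x Ix <-]; exact: I01_scale.
by exists M => x Ix; apply: fM; exact: I01_scale.
Qed.

Lemma eq_int01 f g : (forall x, I01 x -> f x = g x) -> int01 f = int01 g.
Proof. by move=> fg; apply: eq_Rintegral => x /set_mem; exact: fg. Qed.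

Lemma int01D f g : bmeas01 f -> bmeas01 g ->
  int01 (fun x => f x + g x) = int01 f + int01 g.
Proof. by move=> bf bg; apply: RintegralD => //; exact: bmeas01_integrable. Qed.

Lemma int01B f g : bmeas01 f -> bmeas01 g ->
  int01 (fun x => f x - g x) = int01 f - int01 g.
Proof. by move=> bf bg; apply: RintegralB => //; exact: bmeas01_integrable. Qed.

Lemma int01Z c f : bmeas01 f -> int01 (fun x => c * f x) = c * int01 f.
Proof. by move=> bf; apply: RintegralZl => //; exact: bmeas01_integrable. Qed.

Lemma int01_cst c : int01 (fun=> c) = c.
Proof. by rewrite /int01 Rintegral_cst // [X in fine X]mu_I01 mulr1. Qed.

Lemma le_int01 f g : bmeas01 f -> bmeas01 g ->
  (forall x, I01 x -> f x <= g x) -> int01 f <= int01 g.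
Proof.
by move=> bf bg fg; apply: le_Rintegral => //; exact: bmeas01_integrable.
Qed.

Lemma int01_ge0 f : (forall x, I01 x -> 0 <= f x) -> 0 <= int01 f.
Proof. by move=> f0; rewrite /int01; apply: Rintegral_ge0. Qed.

Lemma ler_norm_int01 f : bmeas01 f -> `|int01 f| <= int01 (fun x => `|f x|).
Proof. by move=> bf; apply: le_normr_Rintegral => //; exact: bmeas01_integrable. Qed.

Lemma int01_EFin f : bmeas01 f ->
  (\int[mu]_(x in @I01 R) (f x)%:E)%E = (int01 f)%:E.
Proof.
move=> /bmeas01_integrable bf.
by rewrite /int01 /Rintegral fineK //; exact: integrable_fin_num.
Qed.

(** As a function of [A] the right-hand side is a measure that agrees with [mu] on half-open
    intervals; uniqueness of Lebesgue measure does the rest. *)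
Lemma lebesgue_measure_scale q (A : set R) : 0 < q -> measurable A ->
  mu A = (q%:E * pushforward mu ( *%R q : _ -> measurableTypeR R) A)%E.
Proof.
move=> q0 mA.
pose nq : {nonneg R} := NngNum (ltW q0).
have mq : measurable_fun [set: measurableTypeR R] ( *%R q : R -> measurableTypeR R).
  by have := @mulrl_measurable R setT q; apply.
pose mq_ : {mfun measurableTypeR R >-> measurableTypeR R} :=
  HB.pack ( *%R q : measurableTypeR R -> measurableTypeR R) (isMeasurableFun.Build _ _ _ _ _ mq).
have -> := @lebesgue_measure_unique R (mscale nq (pushforward mu mq_)) _ A mA.
  by rewrite /mscale.
move=> _ [[a b]] _ <-; rewrite /mscale /= /pushforward.
rewrite [RHS](_ : _ = (q%:E * mu `](a / q)%R, (b / q)%R]%classic)%E); last first.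
  congr (_ * lebesgue_measure _)%E.
  apply/seteqP; split=> x /=; rewrite !in_itv /= ltr_pdivrMr // ler_pdivlMr //;
    by rewrite (mulrC q).
rewrite !lebesgue_measure_itv /= !lte_fin ltr_pM2r ?invr_gt0 //.
case: ifP => _; last by rewrite mule0.
by rewrite -!EFinD -EFinM -mulrBl mulrC divfK // gt_eqF.
Qed.

Lemma int01_scale q f : 0 < q <= 1 -> bmeas01 f ->
  int01 (fun x => f (q * x)) = q^-1 * int01 (fun x => if x <= q then f x else 0).
Proof.
move=> /andP[q0 q1].
have q01 : 0 <= q <= 1 by rewrite ltW.
(* A bound [M] of [f] is added: the nonnegative case applies to [f + M] and to the constant [M], and
   subtraction gives the general case. *)
wlog f0 : f / forall x, I01 x -> 0 <= f x.
  move=> H bf; have [mf [M fM]] := bf.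
  have bM : bmeas01 (fun=> M) by exact: bmeas01_cst.
  have bfM := bmeas01D bf bM.
  have b0 := bmeas01_cst 0.
  have f0 x : I01 x -> 0 <= f x + M.
    by move=> /fM; rewrite ler_norml => /andP[h _]; rewrite -lerBlDr sub0r.
  have H1 := H _ f0 bfM.
  have M0 (x : R) : I01 x -> 0 <= M by move=> /fM; exact: le_trans.
  have H2 := H _ M0 bM.
  rewrite int01D // in H1; last exact: bmeas01_scale.
  rewrite H2 in H1; apply: (addIr (q^-1 * int01 (fun x => if x <= q then M else 0))).
  rewrite H1 -mulrDr -int01D; [|exact: bmeas01_if..].
  by congr (_ * _); apply: eq_int01 => x _; case: ifP; rewrite ?addr0.
move=> bf.
have mq : measurable_fun [set: measurableTypeR R] ( *%R q : R -> measurableTypeR R).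
  by have := @mulrl_measurable R setT q; apply.
have pre : ( *%R q) @^-1` `[0, q]%classic = @I01 R.
  apply/seteqP; split=> x /=; rewrite /I01 /= !in_itv /=.
    by rewrite pmulr_rge0 // ger_pMr.
  by rewrite pmulr_rge0 // ger_pMr.
have sub : `[0, q]%classic `<=` @I01 R.
  move=> x; rewrite /I01 /= !in_itv /= => /andP[-> xq]; exact: le_trans q1.
have mf : measurable_fun `[0, q]%classic (EFin \o f).
  by apply/measurable_EFinP; apply: measurable_funS bf.1.
have /= := @ge0_integral_pushforward _ _ _ _ _ _ mq mu `[0, q]%classic (EFin \o f)
  (measurable_itv _) mf.
rewrite pre => E.
have {E} E : (\int[pushforward mu (( *%R q) : _ -> measurableTypeR R)]_(y in `[0%R, q]) (f y)%:E =
  \int[mu]_(x in @I01 R) (f (q * x))%:E)%E.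
  by apply: E => y /[!inE] /sub /f0; rewrite lee_fin.
have Q : (\int[mu]_(y in `[0%R, q]) (f y)%:E =
  q%:E * \int[pushforward mu (( *%R q) : _ -> measurableTypeR R)]_(y in `[0%R, q]) (f y)%:E)%E.
  pose nq : {nonneg R} := NngNum (ltW q0).
  pose mq_ : {mfun measurableTypeR R >-> measurableTypeR R} :=
    HB.pack ( *%R q : measurableTypeR R -> measurableTypeR R) (isMeasurableFun.Build _ _ _ _ _ mq).
  rewrite -(@ge0_integral_mscale _ _ _ (pushforward mu mq_) `[0, q]%classic _ nq (EFin \o f)) //.
    by apply: eq_measure_integral => A mA _; exact: lebesgue_measure_scale.
  by move=> y /sub /f0; rewrite lee_fin.
apply: (mulfI (lt0r_neq0 q0)); rewrite mulrA divff ?mul1r ?gt_eqF //.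
have -> : int01 (fun x => if x <= q then f x else 0) = \int[mu]_(x in `[0, q]) f x.
  have -> : `[0, q]%classic = @I01 R `&` [set x | x <= q].
    apply/seteqP; split=> x /=; rewrite /I01 /= !in_itv /=.
      by move=> /andP[-> xq]; split => //=; apply: le_trans q1.
    by move=> [/andP[-> _] ->].
  rewrite Rintegral_mkcondr; apply: eq_Rintegral => x _; rewrite patchE.
  case: ifPn => xq; first by rewrite mem_set.
  by rewrite memNset // => /= xq'; rewrite xq' in xq.
rewrite /Rintegral Q E (int01_EFin _) /=; last exact: bmeas01_scale.
by [].
Qed.

End BoundedMeasurable.
#[local] Hint Extern 0 (measurable _) => solve [exact: measurable_I01] : core.

(** * The kernel as a function of [x * y], and the L2 size of its increments *)

Section Kernel.
Context {R : realType}.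
Local Notation mu := (@lebesgue_measure R).
Implicit Types (f g : R -> R) (q c d t x y : R).

(** The integral of [(r * f - g) ^+ 2] is a nonnegative quadratic in [r]; its value at [r = B / A]
    is the inequality. *)
Lemma cauchy_schwarz01 f g : bmeas01 f -> bmeas01 g ->
  int01 (fun x => f x * g x) ^+ 2 <=
  int01 (fun x => f x ^+ 2) * int01 (fun x => g x ^+ 2).
Proof.
move=> bf bg.
set A := int01 (fun x => f x ^+ 2); set B := int01 _; set C := int01 (fun x => g x ^+ 2).
have bff : bmeas01 (fun x => f x ^+ 2) by exact: bmeas01X.
have bgg : bmeas01 (fun x => g x ^+ 2) by exact: bmeas01X.
have bfg : bmeas01 (fun x => f x * g x) by exact: bmeas01M.
have A0 : 0 <= A by apply: int01_ge0 => x _; exact: sqr_ge0.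
have quad r : 0 <= r ^+ 2 * A + (- (2 * r)) * B + C.
  rewrite /A /B /C -!int01Z // -!int01D //; try exact: bmeas01Z.
    by apply: int01_ge0 => x _; have := sqr_ge0 (r * f x - g x); nra.
  by apply: bmeas01D; exact: bmeas01Z.
have [A_eq0|A_neq0] := eqVneq A 0.
  rewrite A_eq0 mul0r; have [->|B_neq0] := eqVneq B 0; first by rewrite expr0n.
  (* With [A = 0] the quadratic is affine in [r], and this [r] would give it the value [-1]. *)
  have := quad ((C + 1) / (2 * B)); rewrite A_eq0 mulr0 add0r.
  suff -> : - (2 * ((C + 1) / (2 * B))) * B = - (C + 1) by lra.
  by field.
have := quad (B / A).
have -> : (B / A) ^+ 2 * A + - (2 * (B / A)) * B + C = (A * C - B ^+ 2) / A by field.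
have Agt0 : 0 < A by rewrite lt_neqAle eq_sym A_neq0.
by rewrite pmulr_lge0 ?invr_gt0 // subr_ge0.
Qed.

Lemma ler_norm_int01M f g (a b : R) : bmeas01 f -> bmeas01 g ->
  int01 (fun x => f x ^+ 2) <= a -> int01 (fun x => g x ^+ 2) <= b ->
  `|int01 (fun x => f x * g x)| <= Num.sqrt (a * b).
Proof.
move=> bf bg fa gb; rewrite -sqrtr_sqr; apply: ler_wsqrtr.
apply: le_trans (cauchy_schwarz01 bf bg) _.
by apply: ler_pM => //; apply: int01_ge0 => x _; exact: sqr_ge0.
Qed.

Lemma int01_le d : 0 < d <= 1 -> int01 (fun x => if x <= d then 1 else 0) = d.
Proof.
move=> d01; have := int01_scale d01 (bmeas01_cst 1).
rewrite int01_cst /= => E; have /andP[d0 _] := d01.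
by apply: (mulfI (x := d^-1)); rewrite ?invr_eq0 ?gt_eqF // -E mulVf ?gt_eqF.
Qed.

Lemma bmeas01_inv_max d : 0 < d -> bmeas01 (fun x => (Num.max x d)^-1).
Proof.
move=> d0; have m0 x : 0 < Num.max x d by rewrite lt_max d0 orbT.
split.
  apply: nonincreasing_measurable => // x y xy.
  by rewrite lef_pV2 ?posrE // ge_max !le_max xy lexx orbT.
exists d^-1 => x _; rewrite ger0_norm; last by rewrite invr_ge0 ltW.
by rewrite lef_pV2 ?posrE // le_max lexx orbT.
Qed.

(** The piece up to [d] contributes [1], the piece beyond has primitive [ln]. This integral is the
    source of the logarithms in the estimate. *)
Lemma int01_inv_max d : 0 < d < 1 ->
  int01 (fun x => (Num.max x d)^-1) = 1 - ln d.
Proof.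
move=> /andP[d0 d1].
have intg := bmeas01_integrable (bmeas01_inv_max d0).
have := @Rintegral_itvB R (fun x => (Num.max x d)^-1) (BLeft 0) (BRight 1) d intg.
rewrite !bnd_simp => /(_ (ltW d0) (ltW d1)) /eqP.
rewrite subr_eq => /eqP; rewrite -/(int01 _) => ->.
rewrite Rintegral_itv_obnd_cbnd; last first.
  apply: integrableS intg => //.
  by move=> x /=; rewrite /I01 /= !in_itv /= => /andP[dx ->]; rewrite (le_trans (ltW d0)) // ltW.
rewrite addrC; congr (_ + _).
  rewrite (@eq_Rintegral _ _ _ mu _ (fun=> d^-1)).
    rewrite Rintegral_cst // [X in fine X]lebesgue_measure_itv /= lte_fin d0 /= oppr0 addr0.
    by rewrite mulVf // gt_eqF.
  by move=> x; rewrite inE /= in_itv /= => /andP[_ xd]; rewrite max_r.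
rewrite (@eq_Rintegral _ _ _ mu _ (fun x => x^-1)); last first.
  by move=> x; rewrite inE /= in_itv /= => /andP[dx _]; rewrite max_l.
rewrite /Rintegral (@continuous_FTC2 R (fun x => x^-1) (@ln R) d 1) //.
- by rewrite /= ln1 sub0r.
- apply: continuous_in_subspaceT => x; rewrite inE /= in_itv /= => /andP[dx _].
  by apply: inv_continuous; rewrite gt_eqF // (lt_le_trans d0).
- split.
  + by move=> x; rewrite in_itv /= => /andP[dx _]; case: (is_derive1_ln (lt_trans d0 dx)).
  + by apply: cvg_at_right_filter; exact: continuous_ln.
  + by apply: cvg_at_left_filter; exact: continuous_ln.
- move=> x; rewrite in_itv /= => /andP[dx _].
  by rewrite derive1E; case: (is_derive1_ln (lt_trans d0 dx)).
Qed.

(** The kernel read in the single variable [t = x * y]; the value [0] for [t <= 0] reproduces [Kker]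
    on the axes. *)
Definition kker t : R := if t <= 0 then 0 else 2^-1 - fracpart t^-1.

Lemma Kker_kker x y : I01 x -> I01 y -> Kker x y = kker (x * y).
Proof.
move=> /I01P/andP[x0 x1] /I01P/andP[y0 y1]; rewrite /Kker /kker x1 y1 !andbT.
have [x_gt0|x_le0] := ltP 0 x; last first.
  have -> : x = 0 by apply/eqP; rewrite eq_le x_le0.
  by rewrite mul0r lexx.
have [y_gt0|y_le0] := ltP 0 y; first by rewrite leNgt mulr_gt0.
have -> : y = 0 by apply/eqP; rewrite eq_le y_le0.
by rewrite mulr0 lexx.
Qed.

Lemma fracpart_itv t : 0 <= fracpart t < 1.
Proof. by have := floor_itv t; rewrite /fracpart intrD => /andP[]; lra. Qed.

Lemma kkerE t : 0 < t -> kker t = 2^-1 - fracpart t^-1.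
Proof. by move=> t0; rewrite /kker leNgt t0. Qed.

Lemma kker_norm t : `|kker t| <= 2^-1.
Proof.
rewrite /kker; case: ifP => _; first by rewrite normr0 invr_ge0.
by have := fracpart_itv t^-1 => /andP[]; rewrite ler_norml; lra.
Qed.

Lemma measurable_fracpart : measurable_fun setT (@fracpart R).
Proof.
apply: measurable_funB => //.
by apply: nondecreasing_measurable => // x y xy; rewrite ler_int le_floor.
Qed.

Lemma bmeas01_kker : bmeas01 kker.
Proof.
split; last by exists 2^-1 => t _; exact: kker_norm.
apply: measurable_fun_if => //.
  by apply: measurable_fun_ler => //; exact: measurable_cst.
suff : measurable_fun (`]0%R, +oo[%classic : set R) (fun t : R => 2^-1 - fracpart t^-1).
  apply: measurable_funS => // t [_ /=].
  by rewrite in_itv /= andbT => /negbT; rewrite -ltNge.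
apply: measurable_funB; first exact: measurable_cst.
apply: (@measurableT_comp _ _ _ _ _ _ (@fracpart R)) => //; first exact: measurable_fracpart.
apply: open_continuous_measurable_fun => //.
move=> t; rewrite inE /= in_itv /= andbT => t0.
by apply: inv_continuous; rewrite gt_eqF.
Qed.

Lemma bmeas01_kkerZ c : 0 <= c <= 1 -> bmeas01 (fun y => kker (c * y)).
Proof. by move=> c01; apply: bmeas01_scale => //; exact: bmeas01_kker. Qed.

(* [{t}] is the difference of the nondecreasing functions [t] and [floor t], so
   the increments of their sum dominate those of the kernel. *)
Let upfl t : R := t + (Num.floor t)%:~R.

Let upfl_le t t' : t <= t' -> upfl t <= upfl t'.
Proof. by move=> tt'; apply: lerD => //; rewrite ler_int le_floor. Qed.

Let upfl_le2 t : upfl t <= 2 * t.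
Proof. by rewrite mulr_natl mulr2n lerD2l floor_le. Qed.

Let upfl_ge0 t : 0 <= t -> 0 <= upfl t.
Proof. by move=> t0; rewrite addr_ge0 // ler0z floor_ge0. Qed.

Lemma kker_sqrB_le1 t t' : (kker t - kker t') ^+ 2 <= 1.
Proof.
have := kker_norm t; have := kker_norm t'; rewrite !ler_norml => /andP[? ?] /andP[? ?].
nra.
Qed.

(** An increment of the kernel is at most [1] in absolute value, so its square is at most its
    absolute value, which the monotone function [upfl] controls. *)
Let kker_sqrB t t' : 0 < t' -> t' <= t ->
  (kker t - kker t') ^+ 2 <= upfl t'^-1 - upfl t^-1.
Proof.
move=> t'0 t't; have t0 := lt_le_trans t'0 t't.
have itt : t^-1 <= t'^-1 by rewrite lef_pV2.
have ftt : (Num.floor t^-1)%:~R <= (Num.floor t'^-1)%:~R :> R by rewrite ler_int le_floor.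
have := fracpart_itv t^-1; have := fracpart_itv t'^-1.
rewrite !kkerE // => /andP[+ +] /andP[].
rewrite /upfl /fracpart; set a := t^-1 in itt ftt *; set a' := t'^-1 in itt ftt *.
set b := _%:~R in ftt *; set b' := _%:~R in ftt *.
nra.
Qed.

(** The jumps of [kker] accumulate at [0], so the strip [y <= d] is given up at cost [d]; beyond it
    a monotone majorant yields a bound linear in [1 - q]. *)
Lemma int01_kker_sqrB c q d : 0 < c <= 1 -> 0 < q <= 1 -> 0 < d < 1 ->
  int01 (fun y => (kker (c * y) - kker (q * c * y)) ^+ 2) <=
  d + 2 * (1 - q) / (q * c) * (1 - ln (q * d)).
Proof.
move=> /andP[c0 c1] /andP[q0 q1] /andP[d0 d1].
have qd0 : 0 < q * d by rewrite mulr_gt0.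
have qd1 : q * d < 1 by apply: le_lt_trans d1; rewrite ger_pMl.
(* Off [y <= d] the integrand is at most [F (q y) - F y], whose integral is
   at most [(1/q - 1) * int01 F] by scaling. *)
pose F z := upfl (c * Num.max z (q * d))^-1.
have m0 z : 0 < c * Num.max z (q * d) by rewrite mulr_gt0 // lt_max qd0 orbT.
have F_ni z z' : z <= z' -> F z' <= F z.
  move=> zz'; apply: upfl_le; rewrite lef_pV2 ?posrE // ler_pM2l //.
  by rewrite ge_max !le_max zz' lexx orbT.
have F_ge0 z : 0 <= F z by apply: upfl_ge0; rewrite invr_ge0 ltW.
have F_le z : F z <= 2 / c * (Num.max z (q * d))^-1.
  by apply: le_trans (upfl_le2 _) _; rewrite invfM mulrA.
have bmax := bmeas01_inv_max qd0.
have bF : bmeas01 F.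
  split; first by apply: nonincreasing_measurable => // x y; exact: F_ni.
  by exists (F 0) => x /I01P/andP[x0 _]; rewrite ger0_norm // F_ni.
have bFq : bmeas01 (fun x => F (q * x)) by apply: bmeas01_scale => //; rewrite ltW.
have b1 : bmeas01 (fun x => if x <= d then 1 else 0 : R).
  by apply: bmeas01_if; exact: bmeas01_cst.
have b0F : bmeas01 (fun x => if x <= q then F x else 0).
  by apply: bmeas01_if => //; exact: bmeas01_cst.
apply: (@le_trans _ _ (int01 (fun y => (if y <= d then 1 else 0) + (F (q * y) - F y)))).
  apply: le_int01.
  - apply: bmeas01X; apply: bmeas01B; apply: bmeas01_kkerZ; first by rewrite ltW.
    by rewrite mulr_ge0 ?(ltW q0) ?(ltW c0) //= mulr_ile1 ?(ltW q0) ?(ltW c0).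
  - by apply: bmeas01D => //; exact: bmeas01B.
  move=> y /I01P/andP[y0 y1]; case: ifPn => yd.
    apply: le_trans (kker_sqrB_le1 _ _) _.
    by rewrite lerDl subr_ge0 F_ni // ler_piMl.
  rewrite -ltNge in yd; rewrite add0r.
  have y_gt0 := lt_trans d0 yd.
  apply: le_trans (kker_sqrB _ _) _.
  - by rewrite !mulr_gt0.
  - by rewrite -mulrA ger_pMl // mulr_gt0.
  (* Both [y] and [q * y] lie above the truncation level [q * d], so [F] is untruncated at both
     points. *)
  rewrite /F max_l ?(ler_pM2l) //; last exact: ltW.
  rewrite max_l; last by rewrite ltW // (le_lt_trans _ yd) // ger_pMl.
  by rewrite (mulrC q c) mulrA.
rewrite int01D //; last exact: bmeas01B.
rewrite int01_le ?d0 ?(ltW d1) // lerD2l int01B // int01_scale ?q0 //.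
have leF : int01 (fun x => if x <= q then F x else 0) <= int01 F.
  by apply: le_int01 => // x _; case: ifP.
have leF2 : int01 F <= 2 / c * (1 - ln (q * d)).
  rewrite -int01_inv_max ?qd0 // -int01Z //; apply: le_int01 => //.
  exact: bmeas01Z.
apply: (@le_trans _ _ ((q^-1 - 1) * int01 F)).
  by rewrite mulrBl mul1r lerB // ler_pM2l ?invr_gt0.
have -> : 2 * (1 - q) / (q * c) * (1 - ln (q * d)) = (q^-1 - 1) * (2 / c * (1 - ln (q * d))).
  by field; rewrite !gt_eqF.
by rewrite ler_wpM2l // subr_ge0 invf_ge1.
Qed.

(** A form uniform along an orbit of dilations: [p * q >= 1/2] costs a factor [2] in the denominator
    and lets [ln (d / 2)] replace [ln (p * d)]. *)
Lemma kker_step_le q p x d (e : R) : 0 < x <= 1 -> 0 < d < 1 -> q <= 1 -> p <= 1 ->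
  2^-1 <= p * q -> 0 < p -> 0 < q -> 1 - p <= e ->
  int01 (fun y => (kker (q * x * y) - kker (p * (q * x) * y)) ^+ 2) <=
  d + 4 * e / x * (1 - ln (d / 2)).
Proof.
move=> /andP[x0 x1] /andP[d0 d1] q1 p1 pq p0 q0 pe.
have c0 : 0 < q * x by rewrite mulr_gt0.
have c1 : q * x <= 1 by rewrite mulr_ile1 ?(ltW q0) ?(ltW x0).
have := @int01_kker_sqrB (q * x) p d; rewrite c0 c1 p0 p1 d0 d1 => /(_ isT isT isT).
move=> /le_trans; apply; rewrite lerD2l.
have p2 : 2^-1 <= p by apply: le_trans pq _; rewrite ler_piMr // ltW.
have ln_le : ln (d / 2) <= ln (p * d).
  by rewrite ler_ln ?posrE ?divr_gt0 ?mulr_gt0 // mulrC ler_pM2r.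
have ln0 : ln (p * d) <= 0 by apply: ln_le0; rewrite mulr_ile1 ?(ltW p0) ?(ltW d0) ?(ltW d1).
have e0 : 0 <= 1 - p by rewrite subr_ge0.
apply: ler_pM.
- by apply: divr_ge0; apply: mulr_ge0 => //; exact: ltW.
- lra.
- rewrite ler_pdivrMr; last by rewrite mulr_gt0.
  have -> : 4 * e / x * (p * (q * x)) = 4 * e * (p * q) by field; rewrite gt_eqF.
  nra.
- lra.
Qed.

End Kernel.

(** * Dilation differences of an eigenfunction and their energy *)

Section Eigenfunction.
Context {R : realType}.
Local Notation mu := (@lebesgue_measure R).

(** Since [|K| <= 1/2], the integrand [|K * phi|] is at most [(1 + phi^2) / 4], whose integral is
    [1/2] by normalization. Boundedness of [phi] is not yet known, so the integrals are
    extended-real ones. *)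
Lemma eigenfunction_bound (phi : R -> R) (lam : R) :
  eigenfunction phi lam -> inner01 phi phi = 1 ->
  forall x, I01 x -> `|phi x| <= `|lam| / 2.
Proof.
move=> [[mphi _] [_ phiE]] phi1 x Ix.
(* [fine] sends infinite values to [0], so the value [1] also shows that the integral is finite. *)
have P1 : (\int[mu]_(y in @I01 R) ((phi y) ^+ 2)%:E = 1)%E.
  move: phi1; rewrite /inner01; under eq_integral do rewrite -expr2.
  case: (integral _ _ _) => [r /= ->//| /= /esym/eqP| /= /esym/eqP]; by rewrite oner_eq0.
have mK : measurable_fun (@I01 R) (fun y => Kker x y).
  apply: (eq_measurable_fun (fun y => kker (x * y))).
    by move=> y; rewrite inE => Iy; rewrite Kker_kker.
  by have [] := bmeas01_kkerZ (c := x); [apply/I01P|].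
have mKphi : measurable_fun (@I01 R) (fun y => (Kker x y * phi y)%:E).
  by apply/measurable_EFinP; exact: measurable_funM.
rewrite phiE // normrM ler_wpM2l //.
set J := (X in fine X).
suff : (`|J| <= (2^-1)%:E)%E.
  by case: J => [r| |] //=; rewrite normr0 invr_ge0.
apply: (le_trans (le_abse_integral mu measurable_I01 mKphi)).
apply: (@le_trans _ _ (\int[mu]_(y in @I01 R) ((4^-1)%:E * (1 + ((phi y) ^+ 2)%:E)))%E).
  apply: ge0_le_integral => //.
  - exact: measurableT_comp.
  - apply: measurable_funeM; apply/measurable_EFinP.
    by apply: measurable_funD => //; exact: measurable_funX.
  move=> y Iy; rewrite -EFinD -EFinM /= lee_fin normrM Kker_kker //.
  have := kker_norm (x * y); have := sqr_ge0 (`|phi y| - 1).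
  rewrite -(real_normK (num_real (phi y))).
  by have := normr_ge0 (phi y); have := normr_ge0 (kker (x * y)); nra.
rewrite ge0_integralZl //; last 2 first.
- by apply/measurable_EFinP; apply: measurable_funD => //; exact: measurable_funX.
- by move=> y _; rewrite adde_ge0 ?lee_fin //; exact: sqr_ge0.
rewrite ge0_integralD //; last 2 first.
- by move=> y _; rewrite lee_fin; exact: sqr_ge0.
- by apply/measurable_EFinP; exact: measurable_funX.
rewrite P1 integral_cst // [X in (_ * (_ * X + _))%E]mu_I01 mul1e -EFinD -EFinM lee_fin.
lra.
Qed.

Variables (phi : R -> R) (lam : R).
Hypothesis bphi : bmeas01 phi.
Hypothesis phi_bound : forall x, I01 x -> `|phi x| <= `|lam| / 2.
Hypothesis phi_norm : int01 (fun x => phi x ^+ 2) = 1.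
Hypothesis phiE : forall x, I01 x -> phi x = lam * int01 (fun y => kker (x * y) * phi y).

(** Integrating the square of the pointwise bound gives [1 <= lam^2 / 4]. *)
Lemma eigenvalue_ge2 : 2 <= `|lam|.
Proof.
have : int01 (fun x => phi x ^+ 2) <= int01 (fun=> (`|lam| / 2) ^+ 2).
  apply: le_int01; [exact: bmeas01X|exact: bmeas01_cst|] => x Ix.
  by rewrite -(real_normK (num_real (phi x))) lerXn2r ?nnegrE ?phi_bound // divr_ge0.
rewrite phi_norm int01_cst; have := normr_ge0 lam; nra.
Qed.

(** The difference [D_q]; in the variable [ln x] it is an ordinary backward difference with step
    [- ln q]. *)
Definition dilB (q x : R) := phi x - phi (q * x).

Lemma bmeas01_dilB q : 0 <= q <= 1 -> bmeas01 (dilB q).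
Proof. by move=> q01; apply: bmeas01B => //; exact: bmeas01_scale. Qed.

(** The substitution [z = q * y] has two costs: the strip [q < z <= 1] that the dilated interval
    misses, and the defect [1/q - 1] of the Jacobian. [dil_rem] collects both. *)
Definition dil_layer (q c : R) := int01 (fun z => if z <= q then 0 else kker (c * z) * phi z).
Definition dil_rem (q c : R) := - (q^-1 - 1) * phi c + lam * (q^-1 * dil_layer q c).

(* Substituting [y -> q y] in the integral equation moves the dilation from
   [phi] to the kernel, at the price of the boundary layer [q < z <= 1]. *)
Lemma dilB_integral_eq q c : 0 < q <= 1 -> I01 c ->
  phi c - phi (q * c) =
  - (lam * int01 (fun y => kker (q * c * y) * dilB q y)) + dil_rem q c.
Proof.
move=> q01 Ic; have /andP[q0 q1] := q01.
have q01' : 0 <= q <= 1 by rewrite ltW.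
have Iqc := I01_scale q01' Ic.
have bk c' : I01 c' -> bmeas01 (fun y => kker (c' * y)).
  by move=> /I01P; exact: bmeas01_kkerZ.
have bG : bmeas01 (fun z => kker (c * z) * phi z) by apply: bmeas01M => //; exact: bk.
have b0 : bmeas01 (fun=> 0 : R) by exact: bmeas01_cst.
have E1 : int01 (fun y => kker (q * c * y) * dilB q y) =
    int01 (fun y => kker (q * c * y) * phi y) -
    int01 (fun y => kker (c * (q * y)) * phi (q * y)).
  rewrite -int01B.
  - by apply: eq_int01 => y _; rewrite /dilB mulrBr mulrA (mulrC q c).
  - by apply: bmeas01M => //; exact: bk.
  - exact: (bmeas01_scale q01' bG).
have E2 : int01 (fun z => if z <= q then kker (c * z) * phi z else 0) =
    int01 (fun z => kker (c * z) * phi z) - dil_layer q c.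
  rewrite /dil_layer -int01B //; last exact: bmeas01_if.
  by apply: eq_int01 => z _; case: ifP => _; rewrite ?subr0 ?subrr.
rewrite E1 (int01_scale q01 bG) E2 /dil_rem [phi (q * c)]phiE // [phi c]phiE //.
by ring.
Qed.

Lemma norm_dil_layer_le q c : 0 < q <= 1 -> I01 c -> `|dil_layer q c| <= (1 - q) * (`|lam| / 4).
Proof.
move=> q01 Ic.
have bk : bmeas01 (fun y => kker (c * y)) by apply: bmeas01_kkerZ; apply/I01P.
have b0 a : bmeas01 (fun=> a : R) by exact: bmeas01_cst.
have bf : bmeas01 (fun z => if z <= q then 0 else kker (c * z) * phi z).
  by apply: bmeas01_if => //; exact: bmeas01M.
have bi : bmeas01 (fun z : R => if z <= q then 1 else 0 : R) by exact: bmeas01_if.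
apply: le_trans (ler_norm_int01 bf) _.
have -> : (1 - q) * (`|lam| / 4) =
    int01 (fun z => `|lam| / 4 * (1 - (if z <= q then 1 else 0))).
  by rewrite int01Z; [rewrite int01B // int01_cst int01_le // mulrC|exact: bmeas01B].
apply: le_int01; [exact: bmeas01_norm|by apply: bmeas01Z; exact: bmeas01B|] => z Iz.
case: ifP => _; first by rewrite normr0 subrr mulr0.
rewrite subr0 mulr1 normrM.
have := kker_norm (c * z); have := phi_bound Iz; have := normr_ge0 (phi z).
have := normr_ge0 (kker (c * z)); nra.
Qed.

(** The two terms are at most [(1 - q) * |lam|] and [(1 - q) * lam^2 / 2], and [|lam| <= lam^2 / 2]
    because [|lam| >= 2]. *)
Lemma norm_dil_rem_le q c : 2^-1 <= q <= 1 -> I01 c -> `|dil_rem q c| <= (1 - q) * lam ^+ 2.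
Proof.
move=> /andP[q2 q1] Ic.
have q0 : 0 < q by apply: lt_le_trans q2; rewrite invr_gt0.
have := norm_dil_layer_le (q := q) (c := c); rewrite q0 q1 => /(_ isT Ic) B.
have iq : q^-1 <= 2 by rewrite -[2]invrK lef_pV2 ?posrE ?invr_gt0.
have iq0 : 0 < q^-1 by rewrite invr_gt0.
have L2 := eigenvalue_ge2.
rewrite /dil_rem; apply: le_trans (ler_normD _ _) _.
have -> : - (q^-1 - 1) = - (q^-1 * (1 - q)) by field; rewrite gt_eqF.
rewrite !normrM normrN (ger0_norm (ltW iq0)) (@ger0_norm _ (q^-1 * (1 - q))); last first.
  by rewrite mulr_ge0 ?(ltW iq0) // subr_ge0.
rewrite -(real_normK (num_real lam)).
have P := phi_bound Ic; have P0 := normr_ge0 (phi c).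
have q10 : 0 <= 1 - q by rewrite subr_ge0.
have h1 : q^-1 * (1 - q) * `|phi c| <= 2 * (1 - q) * (`|lam| / 2).
  by apply: ler_pM => //; [rewrite mulr_ge0 ?(ltW iq0) | rewrite ler_wpM2r].
have h2 : `|lam| * (q^-1 * `|dil_layer q c|) <= `|lam| * (2 * ((1 - q) * (`|lam| / 4))).
  by rewrite ler_wpM2l //; apply: ler_pM => //; exact: ltW.
apply: le_trans (lerD h1 h2) _.
have h3 : 0 <= (1 - q) * (`|lam| * (`|lam| - 2)) by rewrite !mulr_ge0 // subr_ge0.
nra.
Qed.

(* One step [q] versus [N] steps: all the differences along the orbit
   [x, q x, ..., q^N x] are governed by nearly the same kernel, and telescope. *)
Lemma dilB_iter_le q x (W r : R) N : 0 < q <= 1 -> I01 x ->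
  (forall i, (i < N)%N ->
     int01 (fun y => (kker (q * x * y) - kker (q ^+ i * (q * x) * y)) ^+ 2) <= W) ->
  (forall i, (i < N)%N -> `|dil_rem q x - dil_rem q (q ^+ i * x)| <= r) ->
  `|N%:R * dilB q x - dilB (q ^+ N) x| <=
  N%:R * (`|lam| * Num.sqrt (W * int01 (fun y => dilB q y ^+ 2)) + r).
Proof.
move=> q01 Ix; have /andP[q0 q1] := q01.
have q01' : 0 <= q <= 1 by rewrite ltW.
have qi01 i : 0 <= q ^+ i <= 1 by rewrite exprn_ge0 ?exprn_ile1 ?(ltW q0).
have bk c : I01 c -> bmeas01 (fun y => kker (c * y)).
  by move=> /I01P; exact: bmeas01_kkerZ.
have bD := bmeas01_dilB q01'.
have Iqx := I01_scale q01' Ix.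
elim: N => [|N IH] HW Hr.
  by rewrite !mul0r expr0 /dilB mul1r subrr subrr normr0.
rewrite -natr1 !mulrDl !mul1r.
have -> : N%:R * dilB q x + dilB q x - dilB (q ^+ N.+1) x =
    (N%:R * dilB q x - dilB (q ^+ N) x) +
    (dilB q x - (phi (q ^+ N * x) - phi (q * (q ^+ N * x)))).
  by rewrite /dilB exprS mulrA; ring.
apply: le_trans (ler_normD _ _) _; apply: lerD.
  by apply: IH => i iN; [apply: HW|apply: Hr]; rewrite ltnS ltnW.
have IqN := I01_scale (qi01 N) Ix.
rewrite [dilB q x](dilB_integral_eq q01 Ix) (dilB_integral_eq q01 IqN).
set T0 := int01 _; set TN := int01 _.
have -> : - (lam * T0) + dil_rem q x - (- (lam * TN) + dil_rem q (q ^+ N * x)) =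
   - (lam * (T0 - TN)) + (dil_rem q x - dil_rem q (q ^+ N * x)) by ring.
apply: le_trans (ler_normD _ _) _; apply: lerD; last by apply: Hr.
rewrite normrN normrM ler_wpM2l // /T0 /TN -int01B; [|by apply: bmeas01M => //; apply: bk..|].
  rewrite (eq_int01 (g := fun y =>
    (kker (q * x * y) - kker (q ^+ N * (q * x) * y)) * dilB q y)).
    apply: ler_norm_int01M => //; last exact: HW.
    by apply: bmeas01B; apply: bk => //; exact: I01_scale.
  by move=> y _; rewrite mulrBl !mulrA (mulrC q (q ^+ N)).
by apply: bmeas01M => //; apply: bk; exact: I01_scale.
Qed.

(** From [(a - b)^2 <= 2 a^2 + 2 b^2], where the dilated square has integral at most [1/p <= 2]. It
    serves for the long step [p = q ^+ N]. *)
Lemma int01_dilB_sqr_le p : 2^-1 <= p <= 1 -> int01 (fun x => dilB p x ^+ 2) <= 6.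
Proof.
move=> /andP[p2 p1]; have p0 : 0 < p by apply: lt_le_trans p2; rewrite invr_gt0.
have p01 : 0 <= p <= 1 by rewrite ltW.
have bphi2 : bmeas01 (fun x => phi x ^+ 2) by exact: bmeas01X.
have bphi2p := bmeas01_scale p01 bphi2.
have E : int01 (fun x => phi (p * x) ^+ 2) <= 2.
  rewrite (int01_scale _ bphi2) ?p0 //.
  apply: (@le_trans _ _ (p^-1 * 1)).
    rewrite ler_wpM2l ?invr_ge0 ?(ltW p0) // -phi_norm.
    apply: le_int01 => //; first by apply: bmeas01_if => //; exact: bmeas01_cst.
    by move=> x _; case: ifP => // _; exact: sqr_ge0.
  by rewrite mulr1 -[2]invrK lef_pV2 ?posrE ?invr_gt0.
apply: (@le_trans _ _ (int01 (fun x => 2 * phi x ^+ 2 + 2 * phi (p * x) ^+ 2))).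
  apply: le_int01.
  - by apply: bmeas01X; exact: bmeas01_dilB.
  - by apply: bmeas01D; exact: bmeas01Z.
  by move=> x _; rewrite /dilB; have := sqr_ge0 (phi x + phi (p * x)); nra.
rewrite int01D; [|exact: bmeas01Z..].
rewrite !int01Z // phi_norm; lra.
Qed.

(* [d0] and [step_bound] make [3 * lam^2 * int01 W <= 1/2] for the majorant [W]
   of the kernel increments below, so that the energy can be absorbed. *)
Let d0 := (24 * lam ^+ 2)^-1.
Let L0 := 1 - ln (d0 / 2).
Definition step_bound := d0 / (2 * L0 ^+ 2).
Definition energy_bound := 144 / step_bound ^+ 2 + 24 * lam ^+ 4.

Let lam2_gt0 : 4 <= lam ^+ 2.
Proof.
have := eigenvalue_ge2; rewrite -(real_normK (num_real lam)); nra.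
Qed.

Let d0_itv : 0 < d0 < 1.
Proof.
have h := lam2_gt0; have h1 : 0 < 24 * lam ^+ 2 by lra.
by rewrite /d0 invr_gt0 h1 invf_lt1 //; lra.
Qed.

Let L0_ge1 : 1 <= L0.
Proof.
have /andP[h1 h2] := d0_itv.
by rewrite /L0 lerDl oppr_ge0 ln_le0 //; lra.
Qed.

Lemma step_bound_itv : 0 < step_bound <= 2^-1.
Proof.
have /andP[h1 h2] := d0_itv; have h3 := L0_ge1.
have h4 : 1 <= L0 ^+ 2 by rewrite exprn_ege1.
have h5 : 0 < 2 * L0 ^+ 2 by nra.
by rewrite /step_bound divr_gt0 //= ler_pdivrMr //; nra.
Qed.

(** Squaring and integrating the orbit comparison puts the energy on both sides; on the right its
    coefficient is [3 * lam^2 * (4 * d0) = 1/2], and absorbing it doubles the factor [3] to [6]. *)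
Lemma dilB_iter_energy h N : 0 < h -> (0 < N)%N -> N%:R * h <= step_bound ->
  int01 (fun x => dilB (expR (- h)) x ^+ 2) <= 6 * (6 / N%:R ^+ 2 + 4 * h ^+ 2 * lam ^+ 4).
Proof.
move=> h0 N0 Nh.
have /andP[sb0 sb2] := step_bound_itv.
have L0_ge0 : 0 <= L0 by exact: le_trans L0_ge1.
have sb_ge0 := ltW sb0.
have N0' : 0 < N%:R :> R by rewrite ltr0n.
set q := expR (- h).
have q0 : 0 < q by exact: expR_gt0.
have q1 : q <= 1 by rewrite -expR0 ler_expR oppr_le0 ltW.
(* [q ^+ i] is [expR (- (i * h))], and [expR t >= 1 + t]: the whole orbit stays within [step_bound]
   of [1]. *)
have qN i : (i <= N)%N -> 1 - step_bound <= q ^+ i.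
  move=> iN; rewrite -expRM_natl; apply: le_trans (expR_ge1Dx _).
  rewrite lerD2l mulrN lerN2; apply: le_trans Nh.
  by rewrite ler_pM2r // ler_nat.
have q2 : 2^-1 <= q by have := qN 1%N N0; rewrite expr1; lra.
have q1h : 1 - q <= h by have := expR_ge1Dx (- h); rewrite -/q; lra.
have q01 : 0 < q <= 1 by rewrite q0.
have q01' : 0 <= q <= 1 by rewrite ltW.
have qi1 i : q ^+ i <= 1 by rewrite exprn_ile1 // ltW.
have /andP[d00 d01] := d0_itv.
set D2 := int01 _.
have D2_ge0 : 0 <= D2 by apply: int01_ge0 => x _; exact: sqr_ge0.
(* For [x <= d0], where the factor [1/x] is too large, the trivial bound [1] is used; above [d0]
   this is [kker_step_le] with cutoff [d0] and [e = step_bound]. *)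
pose W x := (if x <= d0 then 1 else 0) + (d0 + 4 * step_bound * L0 * (Num.max x d0)^-1).
have bW : bmeas01 W.
  apply: bmeas01D; first by apply: bmeas01_if; exact: bmeas01_cst.
  apply: bmeas01D; first exact: bmeas01_cst.
  by apply: bmeas01Z; exact: bmeas01_inv_max.
have posW x : 0 <= 4 * step_bound * L0 * (Num.max x d0)^-1.
  apply: mulr_ge0; first by apply: mulr_ge0 => //; apply: mulr_ge0.
  by rewrite invr_ge0 le_max (ltW d00) orbT.
have W_ge0 x : 0 <= W x.
  rewrite /W addr_ge0 //; first by case: ifP.
  apply: addr_ge0; first exact: ltW.
  exact: posW.
have HW x i : I01 x -> (i < N)%N ->
    int01 (fun y => (kker (q * x * y) - kker (q ^+ i * (q * x) * y)) ^+ 2) <= W x.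
  move=> Ix iN; have /I01P/andP[x0 x1] := Ix; rewrite /W.
  have bk c : I01 c -> bmeas01 (fun y => kker (c * y)).
    by move=> /I01P; exact: bmeas01_kkerZ.
  case: ifPn => [xd|]; last first.
    rewrite -ltNge add0r => xd; rewrite max_l; last exact: ltW.
    have x_gt0 := lt_trans d00 xd.
    have -> : 4 * step_bound * L0 * x^-1 = 4 * step_bound / x * L0 by ring.
    have x01 : 0 < x <= 1 by rewrite x_gt0.
    have pq : 2^-1 <= q ^+ i * q by rewrite -exprSr; have := qN _ iN; lra.
    have p1 : 1 - q ^+ i <= step_bound by have := qN _ (ltnW iN); lra.
    exact: (kker_step_le x01 d0_itv q1 (qi1 i) pq (exprn_gt0 i q0) q0 p1).
  apply: (@le_trans _ _ 1).
    rewrite -[leRHS](int01_cst 1); apply: le_int01; last by move=> y _; exact: kker_sqrB_le1.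
      have Iqx := I01_scale q01' Ix.
      apply: bmeas01X; apply: bmeas01B; apply: bk => //.
      by apply: I01_scale => //; rewrite exprn_ge0 ?qi1 // ltW.
    exact: bmeas01_cst.
  rewrite lerDl; apply: addr_ge0; first exact: ltW.
  exact: posW.
(* The long step, the Cauchy-Schwarz error and the remainders are combined by
   [(a + b + c)^2 <= 3 (a^2 + b^2 + c^2)]. *)
have main x : I01 x -> dilB q x ^+ 2 <=
   3 * (N%:R^-1 ^+ 2 * dilB (q ^+ N) x ^+ 2 + lam ^+ 2 * D2 * W x + (2 * h * lam ^+ 2) ^+ 2).
  move=> Ix.
  have Hr i : (i < N)%N -> `|dil_rem q x - dil_rem q (q ^+ i * x)| <= 2 * h * lam ^+ 2.
    move=> _; apply: le_trans (ler_normB _ _) _.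
    have Iqx : I01 (q ^+ i * x) by apply: I01_scale => //; rewrite exprn_ge0 //= ltW.
    have := norm_dil_rem_le (q := q) (c := x); rewrite q2 q1 => /(_ isT Ix) r1.
    have := norm_dil_rem_le (q := q) (c := q ^+ i * x); rewrite q2 q1 => /(_ isT Iqx) r2.
    apply: le_trans (lerD r1 r2) _; have := sqr_ge0 lam; nra.
  have := dilB_iter_le (N := N) q01 Ix (fun i => @HW x i Ix) Hr.
  rewrite -/D2; set s := Num.sqrt _ => le1.
  have s2 : s ^+ 2 = W x * D2 by rewrite sqr_sqrtr // mulr_ge0.
  have s0 : 0 <= s by exact: sqrtr_ge0.
  have le2 : `|dilB q x| <= N%:R^-1 * `|dilB (q ^+ N) x| + `|lam| * s + 2 * h * lam ^+ 2.
    have -> : dilB q x = N%:R^-1 * dilB (q ^+ N) x +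
        N%:R^-1 * (N%:R * dilB q x - dilB (q ^+ N) x).
      by field; rewrite gt_eqF.
    have iN0 : 0 < N%:R^-1 :> R by rewrite invr_gt0.
    apply: le_trans (ler_normD _ _) _; rewrite -addrA !normrM (gtr0_norm iN0) lerD2l.
    by rewrite [leLHS]mulrC ler_pdivrMr // [leRHS]mulrC.
  rewrite -(real_normK (num_real (dilB q x))) -(real_normK (num_real (dilB (q ^+ N) x))).
  have -> : lam ^+ 2 * D2 * W x = (`|lam| * s) ^+ 2.
    by rewrite exprMn s2 real_normK ?num_real //; ring.
  rewrite -exprMn.
  set a := N%:R^-1 * _ in le2 *; set b := `|lam| * s in le2 *; set c := 2 * h * _ in le2 *.
  apply: (@le_trans _ _ ((a + b + c) ^+ 2)).
    have a0 : 0 <= a by rewrite /a; apply: mulr_ge0 => //; rewrite invr_ge0 ltW.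
    have b0 : 0 <= b by exact: mulr_ge0.
    have c0 : 0 <= c.
      by apply: mulr_ge0; [apply: mulr_ge0 => //; exact: ltW|exact: sqr_ge0].
    by rewrite lerXn2r ?nnegrE // !addr_ge0.
  have := sqr_ge0 (a - b); have := sqr_ge0 (b - c); have := sqr_ge0 (a - c); nra.
have qN01 : 2^-1 <= q ^+ N <= 1.
  by rewrite qi1 andbT; have := qN N (leqnn N); lra.
have bDN : bmeas01 (fun x => dilB (q ^+ N) x ^+ 2).
  by apply: bmeas01X; apply: bmeas01_dilB; rewrite exprn_ge0 ?qi1 // ltW.
(* The three summands give [d0], [d0] and at most [4 * step_bound * L0^2 = 2 * d0]. *)
have intW : int01 W <= 4 * d0.
  rewrite /W int01D; first last.
  - apply: bmeas01D; first exact: bmeas01_cst.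
    by apply: bmeas01Z; exact: bmeas01_inv_max.
  - by apply: bmeas01_if; exact: bmeas01_cst.
  rewrite int01_le ?d00 ?(ltW d01) // int01D; first last.
  - by apply: bmeas01Z; exact: bmeas01_inv_max.
  - exact: bmeas01_cst.
  rewrite int01_cst int01Z; last exact: bmeas01_inv_max.
  rewrite int01_inv_max ?d00 //.
  have lnd : 1 - ln d0 <= L0.
    by rewrite /L0 lerD2l lerN2 ler_ln ?posrE //; lra.
  have L0_gt0 : 0 < L0 by apply: lt_le_trans L0_ge1.
  have : 4 * step_bound * L0 * (1 - ln d0) <= 4 * step_bound * L0 * L0.
    by rewrite ler_wpM2l //; apply: mulr_ge0 => //; apply: mulr_ge0.
  have -> : 4 * step_bound * L0 * L0 = 2 * d0 by rewrite /step_bound; field; rewrite gt_eqF.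
  lra.
have : D2 <= 3 * (N%:R^-1 ^+ 2 * 6 + lam ^+ 2 * D2 * (4 * d0) + (2 * h * lam ^+ 2) ^+ 2).
  apply: (@le_trans _ _ (int01 (fun x => 3 * (N%:R^-1 ^+ 2 * dilB (q ^+ N) x ^+ 2 +
      lam ^+ 2 * D2 * W x + (2 * h * lam ^+ 2) ^+ 2)))).
    apply: le_int01 => //; first by apply: bmeas01X; exact: bmeas01_dilB.
    apply: bmeas01Z; apply: bmeas01D; last exact: bmeas01_cst.
    by apply: bmeas01D; exact: bmeas01Z.
  have bs : bmeas01 (fun x => N%:R^-1 ^+ 2 * dilB (q ^+ N) x ^+ 2 + lam ^+ 2 * D2 * W x).
    by apply: bmeas01D; exact: bmeas01Z.
  rewrite int01Z; last by apply: bmeas01D => //; exact: bmeas01_cst.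
  rewrite ler_wpM2l // int01D //; last exact: bmeas01_cst.
  rewrite int01_cst lerD2r int01D; [|exact: bmeas01Z..].
  rewrite !int01Z //; apply: lerD.
    by apply: ler_wpM2l; [exact: sqr_ge0|exact: int01_dilB_sqr_le].
  by apply: ler_wpM2l => //; apply: mulr_ge0 => //; exact: sqr_ge0.
have -> : lam ^+ 2 * D2 * (4 * d0) = D2 / 6.
  by rewrite /d0; field; have := lam2_gt0; case: eqP => // ->; rewrite expr0n /= lern0.
rewrite exprVn.
have -> : (2 * h * lam ^+ 2) ^+ 2 = 4 * h ^+ 2 * lam ^+ 4 by ring.
by set u := _^-1; set v := 4 * _ * _; lra.
Qed.

(** With [N] the integer part of [step_bound / h], which is at least [2], one has
    [1/N <= 2 * h / step_bound], and both terms of [dilB_iter_energy] become multiples of [h^2]. *)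
Lemma dilB_energy h : 0 < h <= step_bound / 2 ->
  int01 (fun x => dilB (expR (- h)) x ^+ 2) <= energy_bound * h ^+ 2.
Proof.
move=> /andP[h0 hs]; have /andP[sb0 _] := step_bound_itv.
pose N := Num.trunc (step_bound / h).
have Q0 : 0 <= step_bound / h by rewrite divr_ge0 // ltW.
have Q2 : 2 <= step_bound / h by rewrite ler_pdivlMr //; lra.
have /andP[N1 N2] : N%:R <= step_bound / h < N.+1%:R by exact: truncn_itv.
have N0 : (0 < N)%N by rewrite -(ltr_nat R); move: N2; rewrite -natr1; lra.
have N3 : step_bound / h <= 2 * N%:R.
  have : 1 <= N%:R :> R by rewrite ler1n.
  by move: N2; rewrite -natr1; lra.
apply: le_trans (dilB_iter_energy h0 N0 _) _; first by rewrite -ler_pdivlMr.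
have N0' : 0 < N%:R :> R by rewrite ltr0n.
have iN : N%:R^-1 <= 2 * h / step_bound.
  rewrite ler_pdivlMr // mulrC ler_pdivrMr //.
  by move: N3; rewrite ler_pdivrMr //; lra.
have iN2 : (N%:R ^+ 2)^-1 <= (2 * h / step_bound) ^+ 2.
  have iN0 : 0 <= N%:R^-1 :> R by rewrite invr_ge0.
  have iN1 := le_trans iN0 iN.
  by rewrite -exprVn ler_sqr ?nnegrE.
have -> : energy_bound * h ^+ 2 =
    6 * (6 * (2 * h / step_bound) ^+ 2 + 4 * h ^+ 2 * lam ^+ 4).
  by rewrite /energy_bound; field; rewrite gt_eqF.
by rewrite ler_wpM2l // lerD2r ler_wpM2l.
Qed.

End Eigenfunction.

(** * A differentiability criterion by comparison of scales *)

Section DerivableScales.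
Context {R : realType}.

(* The difference quotients at scale [h] agree up to [e] with those at the fixed
   scale [N * h ~ H], which depend continuously on the point; hence Cauchy. *)
Lemma derivable_scales (f : R -> R) (s0 : R) :
  (\forall s \near s0, {for s, continuous f}) ->
  (forall e, 0 < e -> exists2 eta, 0 < eta &
    forall s h N, `|s - s0| < eta -> 0 < h -> (0 < N)%N -> N%:R * h <= eta ->
    `|(f s - f (s - h)) / h - (f s - f (s - N%:R * h)) / (N%:R * h)| <= e) ->
  derivable f s0 1.
Proof.
move=> /nbhs_ballP[r0 /= r00 fc] scales.
rewrite /derivable; apply: cauchy_cvg; apply: cauchy_exP => e e0.
have e40 : 0 < e / 4 by rewrite divr_gt0.
have [eta eta0 sc] := scales _ e40.
(* Small enough for the comparison of scales whenever [N * h <= H], and for [f] to be continuous at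
   [s0 - H]. *)
pose H := Num.min eta r0 / 2.
have H0 : 0 < H by rewrite divr_gt0 // lt_min eta0 r00.
have [Heta Hr0] : H < eta /\ H < r0.
  have : H + H = Num.min eta r0 by rewrite /H; field.
  have : Num.min eta r0 <= eta by rewrite ge_min lexx.
  have : Num.min eta r0 <= r0 by rewrite ge_min lexx orbT.
  lra.
pose Q (p : R * R) := (f p.1 - f (p.1 - p.2)) / p.2.
have Qc : {for (s0, H), continuous Q}.
  have c1 : {for (s0, H), continuous (fun p : R * R => f p.1)}.
    apply: continuous_comp; first exact: cvg_fst.
    by apply: fc; exact: ballxx.
  have c2 : {for (s0, H), continuous (fun p : R * R => f (p.1 - p.2))}.
    apply: (@continuous_comp _ _ _ (fun p : R * R => p.1 - p.2) f).
      by apply: cvgB; [exact: cvg_fst|exact: cvg_snd].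
    by apply: fc; rewrite /= /ball /= opprB addrC subrK gtr0_norm.
  apply: cvgM; first exact: cvgB.
  by apply: cvgV; [rewrite gt_eqF|exact: cvg_snd].
have /nbhs_ballP[r1 /= r10 Qr1] : \forall p \near (s0, H), `|Q (s0, H) - Q p| < e / 4.
  by move/cvgrPdist_lt : Qc; exact.
(* With [N] the integer part of [H / h], the product [N * h] lies within [h] of [H], so continuity
   of [Q] at [(s0, H)] applies. *)
have key s h : `|s - s0| < Num.min eta (Num.min r1 H) -> 0 < h ->
    h < Num.min eta (Num.min r1 H) -> `|(f s - f (s - h)) / h - Q (s0, H)| < e.
  rewrite !lt_min => /and3P[s1 s2 s3] h0 /and3P[h1 h2 h3].
  pose N := Num.trunc (H / h).
  have Q0 : 0 <= H / h by rewrite divr_ge0 // ltW.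
  have Q1 : 1 <= H / h by rewrite ler_pdivlMr // mul1r ltW.
  have /andP[N1 N2] : N%:R <= H / h < N.+1%:R by exact: truncn_itv.
  have N0 : (0 < N)%N by rewrite -(ltr_nat R); move: N2; rewrite -natr1; lra.
  have N3 : N%:R * h <= H by rewrite -ler_pdivlMr.
  have N4 : H < N%:R * h + h.
    by move: N2; rewrite -natr1 ltr_pdivrMr // mulrDl mul1r.
  have le1 := sc s h N s1 h0 N0 (le_trans N3 (ltW Heta)).
  have : `|Q (s0, H) - Q (s, N%:R * h)| < e / 4.
    apply: Qr1; split => /=; rewrite /ball /=; first by rewrite distrC.
    by rewrite ger0_norm; lra.
  rewrite /Q /= => le2.
  set A := (f s - f (s - h)) / h in le1 *; set B := _ / (N%:R * h) in le1 le2.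
  set C := (f s0 - _) / H in le2 *.
  have -> : A - C = (A - B) - (C - B) by ring.
  apply: le_lt_trans (ler_normB _ _) _; lra.
exists (Q (s0, H)).
have r0' : 0 < Num.min eta (Num.min r1 H) by rewrite !lt_min eta0 r10 H0.
suff : \forall h \near 0^', ball (Q (s0, H)) e
    (h^-1 *: ((f \o shift s0) (h *: 1) - f s0)) by [].
near=> h.
have h_neq0 : h != 0 by near: h; exact: nbhs_dnbhs_neq.
have hr : `|h| < Num.min eta (Num.min r1 H).
  by near: h; apply: dnbhs0_lt.
rewrite /ball /= /shift /= distrC /GRing.scale /= mulr1.
(* A forward quotient is the backward quotient based at [s0 + h]; this is why the comparison is
   uniform in base points near [s0]. *)
have [h_gt0|h_le0] := ltP 0 h.
  have := key (h + s0) h; rewrite addrK [h + s0 - h]addrC addKr mulrC.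
  by apply=> //; rewrite gtr0_norm // in hr.
have h_lt0 : h < 0 by rewrite lt_neqAle h_neq0.
have := key s0 (- h); rewrite subrr normr0 opprK oppr_gt0 [s0 + h]addrC.
have -> : (f s0 - f (h + s0)) / - h = h^-1 * (f (h + s0) - f s0) by field.
by apply=> //; rewrite ltr0_norm // in hr.
Unshelve. all: by end_near. Qed.

End DerivableScales.

(** * Continuity and differentiability of an eigenfunction *)

Section Smoothness.
Context {R : realType}.

(** In [kker_step_le] the cutoff [d] takes one half of [v]; the choice of [e] makes the other term
    at most [v / 2], as [x >= x0 / 2]. *)
Lemma kker_step_small (x0 v : R) : 0 < x0 -> 0 < v -> exists2 e, 0 < e &
  forall q p x, x0 / 2 <= x <= 1 -> 0 < q <= 1 -> 0 < p <= 1 ->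
    2^-1 <= p * q -> 1 - p <= e ->
  int01 (fun y => (kker (q * x * y) - kker (p * (q * x) * y)) ^+ 2) <= v.
Proof.
move=> x00 v0; pose d := Num.min (v / 2) 2^-1; pose L := 1 - ln (d / 2).
have d0 : 0 < d by rewrite lt_min divr_gt0 //= invr_gt0.
have dv : d <= v / 2 by rewrite ge_min lexx.
have d2 : d <= 2^-1 by rewrite ge_min lexx orbT.
have L1 : 1 <= L by rewrite lerDl oppr_ge0 ln_le0 //; lra.
have L0 : 0 < L by exact: lt_le_trans L1.
exists (v * x0 / (16 * L)); first by rewrite divr_gt0 ?mulr_gt0.
move=> q p x /andP[x0x x1] /andP[q0 q1] /andP[p0 p1] pq pe.
have x_gt0 : 0 < x by apply: lt_le_trans x0x; rewrite divr_gt0.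
have x01 : 0 < x <= 1 by rewrite x_gt0.
have d01 : 0 < d < 1 by rewrite d0 (le_lt_trans d2) // invf_lt1 // ltr1n.
apply: le_trans (kker_step_le x01 d01 q1 p1 pq p0 q0 pe) _; rewrite -/L.
have -> : 4 * (v * x0 / (16 * L)) / x * L = v / 2 * (x0 / 2 / x).
  by field; rewrite !gt_eqF.
have : x0 / 2 / x <= 1 by rewrite ler_pdivrMr // mul1r.
have : 0 < v / 2 by rewrite divr_gt0.
nra.
Qed.

(** The strict inequality says that [1 / x0] is not an integer; hence the floor of [1 / t] is
    constant near [x0]. *)
Lemma kker_near (x0 : R) k : 0 < x0 -> (Num.floor x0^-1)%:~R < x0^-1 -> 0 < k ->
  \forall t \near x0, `|kker t - kker x0| < k.
Proof.
move=> x00 mx0 k0; set m := Num.floor x0^-1 in mx0 *.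
have m1 : x0^-1 < m%:~R + 1.
  by have /andP[_] := floor_itv x0^-1; rewrite intrD.
have ic : {for x0, continuous (fun t : R => t^-1)}.
  by apply: inv_continuous; rewrite gt_eqF.
pose r := Num.min k (Num.min (x0^-1 - m%:~R) (m%:~R + 1 - x0^-1)).
have r0 : 0 < r by rewrite !lt_min k0 !subr_gt0 mx0.
near=> t.
have t0 : 0 < t by near: t; exact: lt_nbhsr.
have : `|x0^-1 - t^-1| < r by near: t; move/cvgrPdist_lt : ic; exact.
rewrite !lt_min => /and3P[h1 /ltr_normlP[h2 h3] /ltr_normlP[h4 h5]].
have E : Num.floor t^-1 = m.
  by apply: floor_def; rewrite intrD; apply/andP; split; lra.
rewrite !kkerE // /fracpart E -/m.
suff -> : 2^-1 - (t^-1 - m%:~R) - (2^-1 - (x0^-1 - m%:~R)) = x0^-1 - t^-1 by [].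
by ring.
Unshelve. all: by end_near. Qed.

Variables (phi : R -> R) (lam : R).
Hypothesis bphi : bmeas01 phi.
Hypothesis phi_bound : forall x, I01 x -> `|phi x| <= `|lam| / 2.
Hypothesis phi_norm : int01 (fun x => phi x ^+ 2) = 1.
Hypothesis phiE : forall x, I01 x -> phi x = lam * int01 (fun y => kker (x * y) * phi y).

Lemma norm_dilB_le p x v : 0 <= p <= 1 -> I01 x ->
  int01 (fun y => (kker (x * y) - kker (p * x * y)) ^+ 2) <= v ->
  `|dilB phi p x| <= `|lam| * Num.sqrt v.
Proof.
move=> p01 Ix Hv; have Ipx := I01_scale p01 Ix.
have bk c : I01 c -> bmeas01 (fun y : R => kker (c * y)).
  by move=> /I01P; exact: bmeas01_kkerZ.
rewrite /dilB (phiE Ix) (phiE Ipx) -mulrBr normrM ler_wpM2l //.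
rewrite -int01B; [|by apply: bmeas01M => //; exact: bk..].
rewrite (eq_int01 (g := fun y => (kker (x * y) - kker (p * x * y)) * phi y)).
  rewrite -[v]mulr1; apply: ler_norm_int01M => //; last by rewrite phi_norm.
  by apply: bmeas01B; exact: bk.
by move=> y _; rewrite mulrBl.
Qed.

(** Kernel increments are small in L2 even where [1 / x] is an integer, so Cauchy-Schwarz in the
    integral equation gives continuity at every interior point. *)
Lemma continuous_eigenfunction (x : R) : 0 < x < 1 -> {for x, continuous phi}.
Proof.
move=> /andP[x0 x1]; apply/cvgrPdist_lt => e e0.
have L2 := eigenvalue_ge2 bphi phi_bound phi_norm.
have L0 : 0 < `|lam| by exact: lt_le_trans L2.
pose v := (e / (2 * `|lam|)) ^+ 2.
have t0 : 0 < e / (2 * `|lam|) by rewrite divr_gt0 // mulr_gt0.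
have v0 : 0 < v by exact: exprn_gt0.
have sv : `|lam| * Num.sqrt v < e.
  rewrite sqrtr_sqr (gtr0_norm t0).
  have -> : `|lam| * (e / (2 * `|lam|)) = e / 2 by field; rewrite gt_eqF.
  lra.
have [d d0 small] := kker_step_small x0 v0.
have stepP y p : x <= y <= 1 -> 2^-1 <= p <= 1 -> 1 - p <= d -> `|phi y - phi (p * y)| < e.
  move=> /andP[xy y1] /andP[p2 p1] pd.
  have p0 : 0 < p by apply: lt_le_trans p2; rewrite invr_gt0.
  apply: le_lt_trans sv; apply: norm_dilB_le.
  - by rewrite ltW.
  - by apply/I01P; rewrite y1 (le_trans (ltW x0)).
  have := small 1 p y; rewrite y1 ltr01 lexx p0 p1 mulr1 andbT !mul1r.
  by apply=> //; lra.
near=> y.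
have y1 : y < 1 by near: y; exact: lt_nbhsl.
have y0 : 0 < y by near: y; exact: lt_nbhsr.
have yd : `|x - y| < x * Num.min d 2^-1.
  near: y; apply/nbhs_ballP; exists (x * Num.min d 2^-1) => //=.
  by rewrite mulr_gt0 // lt_min d0 /= invr_gt0.
move: yd; rewrite minr_pMr ?(ltW x0) // lt_min => /andP[yd y2].
(* The smaller of the two points is a dilate of the larger one by a factor close to [1]. *)
have [xy|yx] := leP x y.
  have -> : x = x / y * y by rewrite divfK // gt_eqF.
  rewrite distrC; apply: stepP; rewrite ?xy ?(ltW y1) //.
    rewrite ler_pdivlMr // ler_pdivrMr // mul1r xy andbT.
    by move: y2; rewrite ler0_norm ?subr_le0 // opprB; lra.
  move: yd; rewrite ler0_norm ?subr_le0 // opprB => yd.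
  rewrite lerBlDr -lerBlDl ler_pdivlMr //; nra.
have -> : phi y = phi (y / x * x) by rewrite divfK // gt_eqF.
apply: stepP; rewrite ?lexx ?(ltW x1) //.
  rewrite ler_pdivlMr // ler_pdivrMr // mul1r (ltW yx) andbT.
  by move: y2; rewrite ger0_norm ?subr_ge0 ?(ltW yx) //; lra.
move: yd; rewrite ger0_norm ?subr_ge0 ?(ltW yx) // => yd.
rewrite lerBlDr -lerBlDl ler_pdivlMr //; nra.
Unshelve. all: by end_near. Qed.

Lemma norm_dil_layerB_le q x x' k : 0 < q <= 1 -> I01 x -> I01 x' ->
  (forall z, q < z <= 1 -> `|kker (x * z) - kker (x' * z)| <= k) ->
  `|dil_layer phi q x - dil_layer phi q x'| <= (1 - q) * (k * (`|lam| / 2)).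
Proof.
move=> q01 Ix Ix' Hk; have /andP[q0 q1] := q01.
have bk c : I01 c -> bmeas01 (fun y : R => kker (c * y)).
  by move=> /I01P; exact: bmeas01_kkerZ.
have b0 a : bmeas01 (fun=> a : R) by exact: bmeas01_cst.
have bi : bmeas01 (fun z : R => if z <= q then 1 else 0 : R) by exact: bmeas01_if.
have bf c : I01 c -> bmeas01 (fun z => if z <= q then 0 else kker (c * z) * phi z).
  by move=> Ic; apply: bmeas01_if => //; apply: bmeas01M => //; exact: bk.
rewrite /dil_layer -int01B; [|exact: bf..].
apply: le_trans (ler_norm_int01 _) _; first by apply: bmeas01B; exact: bf.
have -> : (1 - q) * (k * (`|lam| / 2)) =
    int01 (fun z => k * (`|lam| / 2) * (1 - (if z <= q then 1 else 0))).
  by rewrite int01Z; [rewrite int01B // int01_cst int01_le // mulrC|exact: bmeas01B].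
apply: le_int01.
- by apply: bmeas01_norm; apply: bmeas01B; exact: bf.
- by apply: bmeas01Z; exact: bmeas01B.
move=> z Iz; case: ifPn => zq; first by rewrite subr0 normr0 subrr mulr0.
rewrite subr0 mulr1 -mulrBl normrM; apply: ler_pM => //; last exact: phi_bound.
by apply: Hk; have /I01P/andP[_ ->] := Iz; rewrite andbT ltNge.
Qed.

(** For Cauchy quotients the remainders must differ by a small multiple of [1 - q], not just by its
    order of magnitude. The small factor comes from the variation of [phi] and that of the kernel on
    the strip. *)
Lemma norm_dil_remB_le q x x' k : 2^-1 <= q <= 1 -> I01 x -> I01 x' ->
  (forall z, q < z <= 1 -> `|kker (x * z) - kker (x' * z)| <= k) ->
  `|dil_rem phi lam q x - dil_rem phi lam q x'| <=
  (1 - q) * (2 * `|phi x - phi x'| + lam ^+ 2 * k).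
Proof.
move=> /andP[q2 q1] Ix Ix' Hk.
have q0 : 0 < q by apply: lt_le_trans q2; rewrite invr_gt0.
have q01 : 0 < q <= 1 by rewrite q0.
have B := norm_dil_layerB_le q01 Ix Ix' Hk.
have iq : q^-1 <= 2 by rewrite -[2]invrK lef_pV2 ?posrE ?invr_gt0.
have iq0 : 0 < q^-1 by rewrite invr_gt0.
have q10 : 0 <= 1 - q by rewrite subr_ge0.
rewrite /dil_rem.
have -> : - (q^-1 - 1) * phi x + lam * (q^-1 * dil_layer phi q x) -
   (- (q^-1 - 1) * phi x' + lam * (q^-1 * dil_layer phi q x')) =
   - (q^-1 * (1 - q)) * (phi x - phi x') +
   lam * (q^-1 * (dil_layer phi q x - dil_layer phi q x')).
  by field; rewrite gt_eqF.
apply: le_trans (ler_normD _ _) _.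
rewrite !normrM normrN (ger0_norm (ltW iq0)) normrM (ger0_norm (ltW iq0)) (ger0_norm q10).
rewrite [leRHS]mulrDr; apply: lerD.
  by rewrite [leRHS]mulrA; apply: ler_wpM2r => //; rewrite mulrC; apply: ler_wpM2l.
rewrite -(real_normK (num_real lam)).
apply: (@le_trans _ _ (`|lam| * (2 * ((1 - q) * (k * (`|lam| / 2)))))).
  by rewrite ler_wpM2l //; apply: ler_pM => //; exact: ltW.
by rewrite le_eqVlt; apply/orP; left; apply/eqP; field.
Qed.

(** The orbit comparison at a fixed point: the energy bound makes the L2 norm of [dilB phi q] of
    order [h], so small kernel increments leave a small multiple of [h] per step. Non-integrality of
    [1 / x0] controls the remainders, through the kernel near [z = 1]. *)
Lemma dil_quotient_scales (x0 e : R) : 0 < x0 < 1 -> (Num.floor x0^-1)%:~R < x0^-1 -> 0 < e ->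
  exists2 eta, 0 < eta & forall x h N, `|x - x0| < eta -> 0 < h -> (0 < N)%N ->
    N%:R * h <= eta ->
  `|dilB phi (expR (- h)) x / h - dilB phi (expR (- (N%:R * h))) x / (N%:R * h)| <= e.
Proof.
move=> /andP[x00 x01] nx0 e0.
have L2 := eigenvalue_ge2 bphi phi_bound phi_norm.
have L0 : 0 < `|lam| by exact: lt_le_trans L2.
have /andP[sb0 sb2] := step_bound_itv bphi phi_bound phi_norm.
set G := energy_bound lam.
have G0 : 0 <= Num.sqrt G by exact: sqrtr_ge0.
(* The energy term and one [|lam| * t] make [e / 6], the other [|lam| * t] is at most [e / 6], and
   [k] below contributes [e / 3]. *)
pose t := e / (6 * `|lam| * (1 + Num.sqrt G)).
have t0 : 0 < t by rewrite divr_gt0 // !mulr_gt0 // ltr_pwDl.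
have v0 : 0 < t ^+ 2 by exact: exprn_gt0.
have [d d0 small] := kker_step_small x00 v0.
pose k := e / (6 * lam ^+ 2).
have lam2 : 0 < lam ^+ 2 by rewrite -(real_normK (num_real lam)) exprn_gt0.
have k0 : 0 < k by rewrite divr_gt0 // mulr_gt0.
have /nbhs_ballP[r /= r0 kr] := kker_near x00 nx0 k0.
(* The bounds serve, in order, the kernel increments, the energy estimate, the points
   [q ^+ i * x * z] (within [3 * m < r] of [x0]), and [x0 / 2 <= x <= 1]. *)
pose m := Num.min (Num.min d (step_bound lam / 2)) (Num.min (Num.min (r / 4) (x0 / 2)) (1 - x0)).
have m0 : 0 < m by rewrite !lt_min subr_gt0; apply/and3P; split=> //; lra.
have [[m1 m2] [m3 m4] m5] : [/\ m <= d /\ m <= step_bound lam / 2, m <= r / 4 /\ m <= x0 / 2 &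
    m <= 1 - x0].
  by split; [split|split|]; rewrite !ge_min lexx ?orbT.
exists m => // x h N xx0 h0 N0 Nh.
have N0' : 0 < N%:R :> R by rewrite ltr0n.
have N1 : 1 <= N%:R :> R by rewrite ler1n.
have hm : h <= m by apply: le_trans Nh; rewrite ler_peMl // ltW.
move: xx0; rewrite ltr_norml => /andP[xl xr].
have Ix : I01 x by apply/I01P; apply/andP; split; lra.
have x_ge : x0 / 2 <= x <= 1 by apply/andP; split; lra.
set q := expR (- h).
have q0 : 0 < q by exact: expR_gt0.
have q1 : q <= 1 by rewrite -expR0 ler_expR oppr_le0 ltW.
have q01 : 0 < q <= 1 by rewrite q0.
have qN i : (i <= N)%N -> 1 - m <= q ^+ i.
  move=> iN; rewrite -expRM_natl; apply: le_trans (expR_ge1Dx _).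
  rewrite lerD2l mulrN lerN2; apply: le_trans Nh.
  by rewrite ler_pM2r // ler_nat.
have q2 : 2^-1 <= q by have := qN 1%N N0; rewrite expr1; lra.
have q1h : 1 - q <= h by have := expR_ge1Dx (- h); rewrite -/q; lra.
have qi01 i : 0 < q ^+ i <= 1 by rewrite exprn_gt0 // exprn_ile1 // ltW.
have HW i : (i < N)%N ->
    int01 (fun y => (kker (q * x * y) - kker (q ^+ i * (q * x) * y)) ^+ 2) <= t ^+ 2.
  move=> iN; apply: small => //.
    by rewrite -exprSr; have := qN _ iN; lra.
  by have := qN _ (ltnW iN); lra.
have Hr i : (i < N)%N -> `|dil_rem phi lam q x - dil_rem phi lam q (q ^+ i * x)| <=
    h * (2 * (`|lam| * t) + lam ^+ 2 * (2 * k)).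
  move=> iN; have /andP[qi0 qi1] := qi01 i.
  have qi := qN _ (ltnW iN).
  have Iqx : I01 (q ^+ i * x) by apply: I01_scale => //; rewrite ltW.
  have /I01P/andP[x_ge0 x_le1] := Ix.
  have Hk z : q < z <= 1 -> `|kker (x * z) - kker (q ^+ i * x * z)| <= 2 * k.
    move=> /andP[qz z1].
    have qz' : 1 - m < z by have := qN 1%N N0; rewrite expr1; lra.
    have z0 : 0 < z by exact: lt_trans qz.
    have a1 : x - m <= x * z <= x by apply/andP; split; nra.
    have a2 : x * z - m <= q ^+ i * x * z <= x * z.
      have : 0 <= x * z <= 1 by apply/andP; split; nra.
      by rewrite -mulrA => /andP[? ?]; apply/andP; split; nra.
    have k1 : `|kker (x * z) - kker x0| < k.
      by apply: kr; rewrite /ball /= ltr_norml; move: a1 => /andP[]; lra.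
    have k2 : `|kker (q ^+ i * x * z) - kker x0| < k.
      by apply: kr; rewrite /ball /= ltr_norml; move: a1 a2 => /andP[? ?] /andP[]; lra.
    move: k1 k2; rewrite !ltr_norml ler_norml => /andP[? ?] /andP[? ?].
    by apply/andP; split; lra.
  have q21 : 2^-1 <= q <= 1 by rewrite q2.
  apply: le_trans (norm_dil_remB_le q21 Ix Iqx Hk) _.
  have pp : `|phi x - phi (q ^+ i * x)| <= `|lam| * t.
    have := @norm_dilB_le (q ^+ i) x (t ^+ 2); rewrite sqrtr_sqr (gtr0_norm t0).
    apply=> //; first by rewrite ltW.
    have := small 1 (q ^+ i) x x_ge; rewrite ltr01 lexx !mul1r mulr1.
    by apply=> //; lra.
  apply: ler_pM => //; first by rewrite subr_ge0.
    by apply: addr_ge0; [exact: mulr_ge0|apply: mulr_ge0; [exact: ltW|lra]].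
  by rewrite lerD2r ler_wpM2l.
have main := dilB_iter_le bphi phiE q01 Ix HW Hr.
have en : int01 (fun y => dilB phi q y ^+ 2) <= G * h ^+ 2.
  by apply: (dilB_energy bphi phi_bound phi_norm phiE); rewrite h0; lra.
have sq : Num.sqrt (t ^+ 2 * int01 (fun y => dilB phi q y ^+ 2)) <= t * (Num.sqrt G * h).
  apply: (@le_trans _ _ (Num.sqrt (t ^+ 2 * (G * h ^+ 2)))).
    by apply: ler_wsqrtr; rewrite ler_pM2l.
  rewrite sqrtrM ?sqr_ge0 // sqrtr_sqr (ger0_norm (ltW t0)) ler_wpM2l ?(ltW t0) //.
  by rewrite mulrC sqrtrM ?sqr_ge0 // sqrtr_sqr (ger0_norm (ltW h0)) mulrC.
have -> : expR (- (N%:R * h)) = q ^+ N by rewrite /q -expRM_natl mulrN.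
have -> : dilB phi q x / h - dilB phi (q ^+ N) x / (N%:R * h) =
    (N%:R * dilB phi q x - dilB phi (q ^+ N) x) / (N%:R * h).
  by field; rewrite !gt_eqF.
have Nh0 : 0 < N%:R * h by exact: mulr_gt0.
rewrite normrM normfV (gtr0_norm Nh0) ler_pdivrMr //.
apply: le_trans main _; rewrite [leRHS]mulrCA ler_pM2l //.
have le1 : `|lam| * Num.sqrt (t ^+ 2 * int01 (fun y => dilB phi q y ^+ 2)) <=
    `|lam| * (t * (Num.sqrt G * h)) by rewrite ler_wpM2l.
apply: (@le_trans _ _ (h * (`|lam| * t * Num.sqrt G + (2 * (`|lam| * t) + lam ^+ 2 * (2 * k))))).
  rewrite [leRHS]mulrDr lerD2r; apply: le_trans le1 _.
  by rewrite le_eqVlt; apply/orP; left; apply/eqP; ring.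
rewrite [leRHS]mulrC ler_pM2l //.
have lam0 : lam != 0 by rewrite -normr_gt0.
have E1 : lam ^+ 2 * (2 * k) = e / 3 by rewrite /k; field.
have E2 : `|lam| * t * (1 + Num.sqrt G) = e / 6.
  by rewrite /t; field; rewrite (gt_eqF L0) gt_eqF //; lra.
have E3 : 0 < `|lam| * t by exact: mulr_gt0.
have E4 : 0 <= `|lam| * t * Num.sqrt G by rewrite mulr_ge0 // ltW.
rewrite E1; lra.
Qed.

(** In the variable [ln x] dilations become translations, which puts the comparison of scales in the
    form of [derivable_scales]. *)
Lemma derivable_eigenfunction_exp (x0 : R) : 0 < x0 < 1 ->
  (Num.floor x0^-1)%:~R < x0^-1 -> derivable (phi \o expR) (ln x0) 1.
Proof.
move=> x01 nx0; have /andP[x0_gt0 x0_lt1] := x01.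
apply: derivable_scales.
  near=> s; apply: continuous_comp; first exact: continuous_expR.
  apply: continuous_eigenfunction; rewrite expR_gt0 /= -expR0 ltr_expR.
  by near: s; apply: lt_nbhsl; rewrite ln_lt0 // x01.
move=> e e0; have [eta eta0 H] := dil_quotient_scales x01 nx0 e0.
have /cvgrPdist_lt /(_ _ eta0) /nbhs_ballP[r /= r0 er] := @continuous_expR R (ln x0).
exists (Num.min r eta); first by rewrite lt_min r0.
move=> s h N; rewrite lt_min le_min => /andP[sr _] h0 N0 /andP[_ Nh].
have := H (expR s) h N; rewrite /dilB -!expRD /= [- h + s]addrC [- (N%:R * h) + s]addrC.
apply=> //; rewrite distrC -[X in `|X - _|](lnK (x := x0)) ?posrE //.
by apply: er; rewrite /ball /= distrC.
Unshelve. all: by end_near. Qed.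

Lemma derivable_eigenfunction (x0 : R) (u : nat -> R) : 0 < x0 < 1 ->
  (Num.floor x0^-1)%:~R < x0^-1 -> (forall n, 0 < u n) -> u @ \oo --> (0 : R) ->
  derivable phi x0 1 /\
  (dilB phi (expR (- u n)) x0 / u n @[n --> \oo] --> x0 * derive1 phi x0).
Proof.
move=> x01 nx0 u_gt0 ucv; have /andP[x0_gt0 x0_lt1] := x01.
have dg := derivable_eigenfunction_exp x01 nx0.
set g := phi \o expR in dg.
have g' : is_derive (ln x0) 1 g ('D_1 g (ln x0)) by exact: derivableP.
have dphi : is_derive x0 1 (g \o @ln R) (x0^-1 * 'D_1 g (ln x0)).
  by have := is_derive1_comp g' (is_derive1_ln x0_gt0); rewrite mulrC.
have eqphi : {near x0, g \o @ln R =1 phi}.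
  near=> y; have y0 : 0 < y by near: y; exact: lt_nbhsr.
  by rewrite /g /= lnK // posrE.
have phi' : is_derive x0 1 phi (x0^-1 * 'D_1 g (ln x0)).
  by apply: near_eq_is_derive dphi; rewrite ?oner_neq0.
split; first by case: phi'.
rewrite derive1E (@derive_val _ _ _ _ _ _ _ phi') mulrA divff ?gt_eqF // mul1r.
have := dg; rewrite /derivable => /cvg_ex [l gl].
have -> : 'D_1 g (ln x0) = l by apply: cvg_lim.
(* The derivative is a limit over punctured neighbourhoods, and [- u n] never vanishes. *)
have un : (- u n) @[n --> \oo] --> (0 : R)^'.
  have u0 : (- u n) @[n --> \oo] --> (0 : R) by rewrite -oppr0; exact: cvgN.
  move=> A hA.
  have hB : \forall n \near \oo, - u n != 0 -> A (- u n) by exact: (u0 _ hA).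
  by apply: filterS hB => n; apply; rewrite oppr_eq0 gt_eqF.
have := cvg_comp _ _ un gl; apply: cvg_trans; apply: near_eq_cvg.
near=> n.
rewrite /= /dilB /GRing.scale /= mulr1 /g /shift /= expRD !lnK ?posrE //.
by rewrite invrN mulNr -mulrN opprB mulrC.
Unshelve. all: by end_near. Qed.


End Smoothness.

(** * Growth of the energy bound in [lam] *)

Section EnergyBound.
Context {R : realType}.

(** The energy bound is of order [|lam|^4 (ln |lam|)^4]; one logarithm is traded for a factor
    [|lam|]. In the second term, [192 = 24 * 8] comes from [(ln |lam|)^3 >= 1/8]. *)
Lemma energy_bound_le (lam : R) : 2 <= `|lam| ->
  energy_bound lam <=
  (144 * 48 ^+ 2 * 98 ^+ 4 + 192) * `|lam| ^+ 5 * ln `|lam| ^+ 3.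
Proof.
move=> L2; set a := `|lam|; pose l := ln a.
have a0 : 0 < a by exact: lt_le_trans L2.
have lam2 : lam ^+ 2 = a ^+ 2 by rewrite /a real_normK ?num_real.
have lam4 : lam ^+ 4 = a ^+ 4 by rewrite (exprM _ 2 2) lam2 -exprM.
have ln_ge (x : R) : 0 < x -> 1 - x^-1 <= ln x.
  move=> x0; have ix : 0 < x^-1 by rewrite invr_gt0.
  have := @le_ln1Dx R (x^-1 - 1); rewrite [1 + _]addrC subrK lnV ?posrE //.
  by move=> /(_ _); rewrite -subr_gt0 opprK subrK => /(_ ix); lra.
have ln_le (x : R) : 0 < x -> ln x <= x - 1.
  move=> x0; have := @le_ln1Dx R (x - 1); rewrite [1 + _]addrC subrK.
  by apply; rewrite -subr_gt0 opprK subrK.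
have l2 : 2^-1 <= l.
  have : ln 2 <= l by rewrite ler_ln ?posrE.
  have := ln_ge 2; lra.
have la : l <= a by have := ln_le a a0; rewrite -/l; lra.
pose d := (24 * lam ^+ 2)^-1; pose L := 1 - ln (d / 2).
(* [L = 1 + ln 48 + 2 * l], where [1 + ln 48 <= 48 <= 96 * l] because [l >= 1/2]. *)
have L_le : L <= 98 * l.
  have -> : L = 1 + ln 48 + 2 * l.
    rewrite /L /d lam2.
    have -> : (24 * a ^+ 2)^-1 / 2 = (48 * (a * a))^-1 by field; rewrite gt_eqF.
    rewrite lnV ?posrE ?mulr_gt0 // lnM ?posrE ?mulr_gt0 // lnM ?posrE //.
    by rewrite -/l; ring.
  have := ln_le 48; lra.
have L_ge : 1 <= L.
  have d0 : 0 < d by rewrite invr_gt0 lam2 mulr_gt0 // exprn_gt0.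
  rewrite /L lerDl oppr_ge0 ln_le0 // /d lam2.
  have -> : (24 * a ^+ 2)^-1 / 2 = (48 * a ^+ 2)^-1 by field; rewrite gt_eqF.
  rewrite invf_le1 ?mulr_gt0 ?exprn_gt0 //; nra.
have -> : energy_bound lam = 144 * 48 ^+ 2 * (a ^+ 4 * L ^+ 4) + 24 * a ^+ 4.
  rewrite /energy_bound /step_bound -/d -/L lam4 /d lam2.
  by field; rewrite !gt_eqF // (lt_le_trans _ L_ge).
have a4 : 0 < a ^+ 4 by exact: exprn_gt0.
have l3 : 8^-1 <= l ^+ 3.
  have -> : 8^-1 = 2^-1 ^+ 3 :> R by rewrite exprVn; congr (_^-1); ring.
  by rewrite lerXn2r ?nnegrE ?invr_ge0 // (le_trans _ l2) ?invr_ge0.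
have l0 : 0 < l by apply: lt_le_trans l2; rewrite invr_gt0.
have p1 : a ^+ 4 * L ^+ 4 <= 98 ^+ 4 * (a ^+ 5 * l ^+ 3).
  apply: (@le_trans _ _ (a ^+ 4 * (98 * l) ^+ 4)).
    rewrite ler_pM2l //; apply: lerXn2r => //.
      by rewrite nnegrE (le_trans _ L_ge).
    by rewrite nnegrE mulr_ge0 // ltW.
  rewrite exprMn mulrCA ler_pM2l ?exprn_gt0 //.
  rewrite [a ^+ 5]exprSr [l ^+ 4]exprS mulrA ler_pM2r ?exprn_gt0 //.
  by rewrite ler_pM2l.
have p2 : 24 * a ^+ 4 <= 192 * (a ^+ 5 * l ^+ 3).
  have : a ^+ 4 * (1 * 8^-1) <= a ^+ 4 * (a * l ^+ 3).
    by rewrite ler_pM2l //; apply: ler_pM => //; rewrite ?invr_ge0 // (le_trans _ L2) // ler1n.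
  by rewrite mulrA -exprSr mul1r => h; move: (a ^+ 4) (a ^+ 5 * l ^+ 3) h => x y; lra.
rewrite -/l -[leRHS]mulrA [leRHS]mulrDl; apply: lerD => //.
by rewrite -[leRHS]mulrA ler_pM2l // mulr_gt0 // exprn_gt0.
Qed.

End EnergyBound.

(** * The countable exceptional set *)

Section ExceptionalSet.
Context {R : realType}.
Local Notation mu := (@lebesgue_measure R).

(** The points of [[0, 1]] where [1 / x] is an integer; the convention [0^-1 = 0] puts [0] among
    them, and [n = 1] gives the other endpoint. *)
Definition inv_nats : set R := range (fun n : nat => n%:R^-1).

Lemma countable_inv_nats : countable inv_nats.
Proof. by apply: sub_countable (card_image_le _ _) _; exact: countableP. Qed.

Lemma measurable_inv_nats : measurable inv_nats.
Proof. by apply: countable_measurable countable_inv_nats => x; exact: measurable_set1. Qed.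

Lemma mu_inv_nats : mu inv_nats = 0%E.
Proof. exact: countable_lebesgue_measure0 countable_inv_nats. Qed.

Lemma inv_natsN (x : R) : I01 x -> ~ inv_nats x ->
  0 < x < 1 /\ (Num.floor x^-1)%:~R < x^-1.
Proof.
move=> /I01P/andP[x0 x1] Nx.
have x_gt0 : 0 < x.
  rewrite lt_neqAle x0 andbT; apply/eqP => x_eq0; apply: Nx.
  by exists 0%N => //; rewrite invr0.
split.
  rewrite x_gt0 lt_neqAle x1 andbT; apply/eqP => x_eq1; apply: Nx.
  by exists 1%N => //; rewrite x_eq1 invr1.
rewrite lt_neqAle floor_le andbT; apply/eqP => E; apply: Nx.
have : (0 <= Num.floor x^-1) by rewrite floor_ge0 invr_ge0.
case: (Num.floor x^-1) E => // n E _.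
by exists n => //; rewrite -[x]invrK -E.
Qed.

(** All subsets of a countable set are measurable. This handles [derive1] at exceptional points,
    where differentiability is not established. *)
Lemma measurable_fun_countable (D : set R) (f : R -> R) : countable D -> measurable_fun D f.
Proof.
move=> cD mD A mA; apply: countable_measurable => [x|]; first exact: measurable_set1.
by apply: sub_countable cD; apply: subset_card_le; exact: subIsetl.
Qed.

Lemma limn_einf_le (u : nat -> \bar R) (M : \bar R) :
  (forall n, (u n <= M)%E) -> (limn_einf u <= M)%E.
Proof.
move=> uM; rewrite limn_einf_lim; apply: lime_le; first exact: is_cvg_einfs.
near=> n; apply: le_trans (uM n); apply: ereal_inf_lbound.
by exists n => //=.
Unshelve. all: by end_near. Qed.

End ExceptionalSet.

(** * Passage to the limit in the difference quotients *)

Theorem theorem4p11 (R : realType) :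
  exists C : R, 0 < C /\
  forall (phi : nat -> R -> R) (lam : nat -> R),
    ordered_max_eigensystem phi lam ->
    forall j : nat,
      {ae (@lebesgue_measure R), forall x : R,
          @I01 R x -> derivable (phi j) x 1} /\
      L2_01 (fun x => x * derive1 (phi j) x) /\
      (\int[(@lebesgue_measure R)]_(x in @I01 R)
          ((x * derive1 (phi j) x) ^+ 2)%:E
        <= (C * `|lam j| ^+ 5 * (ln `|lam j|) ^+ 3)%:E)%E.
Proof.
exists (144 * 48 ^+ 2 * 98 ^+ 4 + 192); split.
  by rewrite addr_gt0 // !mulr_gt0 // exprn_gt0.
move=> phis lams [eig orth _ _ _] j.
have [_ eigj] := eig j; have := orth j j; rewrite eqxx => norm1.
move: (phis j) (lams j) eigj norm1 => phi lam eigj norm1 {eig orth phis lams}.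
have phi_bound := eigenfunction_bound eigj norm1.
have [[mphi _] [_ phiE0]] := eigj.
have bphi : bmeas01 phi by split => //; exists (`|lam| / 2).
have phi_norm : int01 (fun x => phi x ^+ 2) = 1.
  by rewrite -norm1; apply: eq_int01 => x _; rewrite expr2.
have phiE x : I01 x -> phi x = lam * int01 (fun y => kker (x * y) * phi y).
  move=> Ix; rewrite phiE0 //; congr (_ * _).
  by apply: eq_int01 => y Iy; rewrite Kker_kker.
have L2 := eigenvalue_ge2 bphi phi_bound phi_norm.
have /andP[sb0 _] := step_bound_itv bphi phi_bound phi_norm.
(* A positive null sequence that stays in the range of [dilB_energy] from its first term. *)
pose u (n : nat) : R := step_bound lam / 2 * n.+1%:R^-1.
have u_gt0 n : 0 < u n by apply: mulr_gt0; [exact: divr_gt0|rewrite invr_gt0 ltr0n].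
have u_le n : u n <= step_bound lam / 2.
  apply: ler_piMr; first by rewrite divr_ge0 // ltW.
  by rewrite invf_le1 ?ler1n ?ltr0n.
have u_cv : u @ \oo --> (0 : R).
  rewrite -[X in _ --> X](mulr0 (step_bound lam / 2)).
  by apply: cvgM; [exact: cvg_cst|exact: cvg_harmonic].
pose D := @I01 R `\` inv_nats.
have mD : measurable D by apply: measurableD => //; exact: measurable_inv_nats.
have good x : D x -> derivable phi x 1 /\
    (dilB phi (expR (- u n)) x / u n @[n --> \oo] --> x * derive1 phi x).
  move=> [Ix Nx]; have [x01 nx] := inv_natsN Ix Nx.
  exact: (derivable_eigenfunction bphi phi_bound phi_norm phiE x01 nx u_gt0 u_cv).
pose g n x := dilB phi (expR (- u n)) x / u n.
have q01 n : 0 <= expR (- u n) <= 1.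
  by rewrite expR_ge0 -expR0 ler_expR oppr_le0 ltW.
have bg n : bmeas01 (g n).
  apply: bmeas01M; [exact: bmeas01_dilB|exact: bmeas01_cst].
have DI : D `<=` @I01 R by exact: subIsetl.
have mI : measurable (@I01 R `&` inv_nats) by apply: measurableI => //; exact: measurable_inv_nats.
have I01E : @I01 R = D `|` (@I01 R `&` inv_nats) by rewrite setUC setUIDK.
have mf : measurable_fun (@I01 R) (fun x => x * derive1 phi x).
  rewrite I01E; apply/measurable_funU => //; split.
    apply: (@measurable_fun_cvg _ _ _ _ g) => [n|x /good[_ ]] //.
    exact: measurable_funS (bg n).1.
  apply: measurable_fun_countable; apply: sub_countable countable_inv_nats.
  by apply: subset_card_le; exact: subIsetr.
have mf2 : measurable_fun (@I01 R) (fun x => ((x * derive1 phi x) ^+ 2)%:E).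
  by apply/measurable_EFinP; exact: measurable_funX.
have f0 x : (0 <= ((x * derive1 phi x) ^+ 2)%:E)%E by rewrite lee_fin sqr_ge0.
have energy n : (\int[lebesgue_measure]_(x in @I01 R) (g n x ^+ 2)%:E <= (energy_bound lam)%:E)%E.
  rewrite (int01_EFin (bmeas01X 2 (bg n))) lee_fin.
  have bd2 : bmeas01 (fun x => dilB phi (expR (- u n)) x ^+ 2).
    by apply: bmeas01X; exact: bmeas01_dilB.
  have -> : int01 (fun x => g n x ^+ 2) =
      (u n ^+ 2)^-1 * int01 (fun x => dilB phi (expR (- u n)) x ^+ 2).
    by rewrite -int01Z //; apply: eq_int01 => x _; rewrite /g exprMn exprVn mulrC.
  rewrite mulrC ler_pdivrMr ?exprn_gt0 //.
  by apply: (dilB_energy bphi phi_bound phi_norm phiE); rewrite u_gt0 u_le.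
have bound : (\int[lebesgue_measure]_(x in @I01 R) ((x * derive1 phi x) ^+ 2)%:E <=
    (energy_bound lam)%:E)%E.
  (* The null set is removed first; on [D] the squared quotients converge pointwise, so the
     integrand is their lower limit and Fatou's lemma applies. *)
  have -> : (\int[lebesgue_measure]_(x in @I01 R) ((x * derive1 phi x) ^+ 2)%:E =
     \int[lebesgue_measure]_(x in D) ((x * derive1 phi x) ^+ 2)%:E)%E.
    rewrite [in LHS]I01E ge0_integral_setU //.
    - rewrite [X in (_ + X)%E]null_set_integral ?adde0 //.
        by apply: measurable_funS mf2 => //; exact: subIsetl.
      apply/eqP; rewrite eq_le measure_ge0 andbT -mu_inv_nats.
      by apply: le_measure; rewrite ?inE //; exact: measurable_inv_nats.
    - by rewrite -I01E.
    - by apply/disj_setPS => x [[_ Nx] [_ /Nx]].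
  have -> : (\int[lebesgue_measure]_(x in D) ((x * derive1 phi x) ^+ 2)%:E =
     \int[lebesgue_measure]_(x in D) limn_einf (fun n => (g n x ^+ 2)%:E))%E.
    apply: eq_integral => x /[!inE] /good[_ gx].
    have gx2 : (g n x ^+ 2)%:E @[n --> \oo] --> ((x * derive1 phi x) ^+ 2)%:E.
      apply: cvg_EFin; first exact: nearW.
      by under [X in X @ _ --> _]eq_fun do rewrite /= expr2; rewrite expr2; exact: cvgM.
    by rewrite (cvg_limn_einf_sup gx2).1.
  apply: le_trans (fatou _ _ _ _) _ => //.
  - move=> n; apply/measurable_EFinP; apply: measurable_funX.
    exact: measurable_funS (bg n).1.
  - by move=> n x _; rewrite lee_fin sqr_ge0.
  apply: limn_einf_le => n; apply: le_trans (energy n).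
  apply: ge0_subset_integral => //.
    by apply/measurable_EFinP; exact: (bmeas01X 2 (bg n)).1.
  by move=> x _; rewrite lee_fin sqr_ge0.
split; [|split; [split => //|]].
- exists inv_nats; split; [exact: measurable_inv_nats|exact: mu_inv_nats|].
  move=> x /= /not_implyP[Ix Nx]; apply: contrapT => Sx; apply: Nx.
  by have [] : derivable phi x 1 /\ _ := good x (conj Ix Sx).
- by apply: le_lt_trans bound _; exact: ltry.
- by apply: le_trans bound _; rewrite lee_fin; exact: energy_bound_le.
Qed.
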